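(* Let $G\in\mathrm{Gl}_n(\mathbb{R})$, $D\in\mathbb{R}^{n\times n}$ with $D=D^\top\ge 0$, $B\in\mathbb{R}^{n\times m}$ with $\ker B=\{0\}$, and $$\mathcal{A}=\begin{bmatrix}0&G^\top\\-G&-D\end{bmatrix},\qquad \mathcal{B}=\begin{bmatrix}0\\ B\end{bmatrix}=\mathcal{C}^\top .$$ Suppose that $[\mathcal{A},\mathcal{B},\mathcal{C}]$ is stabilizable and has semi-simple zeros, and let $\mathbf{G}(s)$ be its transfer function. Then $\mathbf{G}(s)$ has a positive real balanced realization $[\mathcal{A}_{\mathrm b},\mathcal{B}_{\mathrm b},\mathcal{C}_{\mathrm b}]$ of the block form $$\mathcal{A}_{\mathrm b}=\begin{bmatrix} 0&0&0&0&0&\hat A_{16}\\ 0&0&0&0&\hat A_{25}&\hat A_{26}\\ 0&0&\hat A_{33}&\hat A_{34}&0&\hat A_{36}\\ 0&0&-\hat A_{34}^\top&\hat A_{44}&0&\hat A_{46}\\ 0&-\hat A_{25}^\top&0&0&0&0\\ -\hat A_{16}^\top&-\hat A_{26}^\top&-\hat A_{36}^\top&\hat A_{46}^\top&0&\hat A_{66} \end{bmatrix},\qquad \mathcal{B}_{\mathrm b}=\begin{bmatrix}0\\0\\0\\0\\0\\\hat B_6\end{bmatrix}=\mathcal{C}_{\mathrm b}^\top,$$ where $\hat A_{16},\hat B_6\in\mathrm{Gl}_m(\mathbb{R})$, $\hat A_{66}\in\mathbb{R}^{m\times m}$, $\hat A_{33}\in\mathbb{R}^{p_1\times p_1}$,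 $\hat A_{44}\in\mathbb{R}^{p_2\times p_2}$, $\hat A_{25}\in\mathbb{R}^{\ell\times\ell}$, and $\hat n=2m+p_1+p_2+2\ell$ is the order of the minimal system. Further, the minimal solutions of the KYP inequalities $\mathcal{W}_{[\mathcal{A}_{\mathrm b},\mathcal{B}_{\mathrm b},\mathcal{C}_{\mathrm b},0]}(P)\le0$ and $\mathcal{W}_{[\mathcal{A}_{\mathrm b}^\top,\mathcal{C}_{\mathrm b}^\top,\mathcal{B}_{\mathrm b}^\top,0]}(Q)\le0$ are given by $P=Q=\operatorname{diag}(I_{m+\ell},\Pi,I_{m+\ell})$ for some diagonal matrix $\Pi\in\mathbb{R}^{(p_1+p_2)\times(p_1+p_2)}$. Moreover, the system $$[\mathcal{A}_{\mathrm z},\mathcal{B}_{\mathrm z},\mathcal{C}_{\mathrm z},\mathcal{D}_{\mathrm z}]:=\left[\begin{bmatrix}\hat A_{33}&\hat A_{34}\\-\hat A_{34}^\top&\hat A_{44}\end{bmatrix},\begin{bmatrix}\hat A_{36}\\\hat A_{46}\end{bmatrix},\begin{bmatrix}\hat A_{36}^\top&-\hat A_{46}^\top\end{bmatrix},-\hat A_{66}\right]$$ is asymptotically stable and positive real balanced, where $\Pi$ is the minimal solution of $\mathcal{W}_{[\mathcal{A}_{\mathrm z},\mathcal{B}_{\mathrm z},\mathcal{C}_{\mathrm z},\mathcal{D}_{\mathrm z}]}(\hat P)\le0$ and of $\mathcal{W}_{[\mathcal{A}_{\mathrm z}^\top,\mathcal{C}_{\mathrm z}^\top,\mathcal{B}_{\mathrm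 z}^\top,\mathcal{D}_{\mathrm z}^\top]}(\hat Q)\le0$, and the spectrum of $\mathcal{A}_{\mathrm z}$ coincides with the set of zeros of $[\mathcal{A}_{\mathrm b},\mathcal{B}_{\mathrm b},\mathcal{C}_{\mathrm b}]$ with negative real part.
   Context: $[\mathcal{A},\mathcal{B},\mathcal{C},\mathcal{D}]$ denotes the system $\dot x=\mathcal{A}x+\mathcal{B}u$, $y=\mathcal{C}x+\mathcal{D}u$, with transfer function $\mathcal{C}(sI-\mathcal{A})^{-1}\mathcal{B}+\mathcal{D}$ (of which it is called a realization); $[\mathcal{A},\mathcal{B},\mathcal{C}]$ means $\mathcal{D}=0$. It is minimal if controllable and observable. For symmetric $P$, $$\mathcal{W}_{[\mathcal{A},\mathcal{B},\mathcal{C},\mathcal{D}]}(P):=\begin{bmatrix}\mathcal{A}^\top P+P\mathcal{A}&P\mathcal{B}-\mathcal{C}^\top\\ \mathcal{B}^\top P-\mathcal{C}&-\mathcal{D}-\mathcal{D}^\top\end{bmatrix}.$$ The inequality $\mathcal{W}(P)\le0$ is the KYP inequality; a minimal solution $P_{\min}\ge 0$ is a positive semidefinite solution with $P_{\min}\le P$ for all positive semidefinite solutions $P$. The system is positive real balanced if the minimal solutions $P_{\min},Q_{\min}$ of $\mathcal{W}_{[\mathcal{A},\mathcal{B},\mathcal{C},\mathcal{D}]}(P)\le0$ and $\mathcal{W}_{[\mathcal{A}^\top,\mathcal{C}^\top,\mathcal{B}^\top,\mathcal{D}^\top]}(Q)\le 0$ satisfy $P_{\min}=Q_{\min}=\operatorname{diag}(\sigma_1I_{n_1},\dots,\sigma_hI_{n_h})$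 with distinct $\sigma_i\in(0,1]$ (in no prescribed order). Zeros: $\mu\in\mathbb{C}$ is a zero of $[\mathcal{A},\mathcal{B},\mathcal{C},\mathcal{D}]$ if the complex rank of $\begin{bmatrix}-\mu I+\mathcal{A}&\mathcal{B}\\\mathcal{C}&\mathcal{D}\end{bmatrix}$ is smaller than the rank over $\mathbb{R}(s)$ of $\begin{bmatrix}-sI+\mathcal{A}&\mathcal{B}\\\mathcal{C}&\mathcal{D}\end{bmatrix}$. When the transfer function is square and invertible (which is the case here), a zero $\mu$ is semi-simple if its order as a zero of the determinant of this pencil equals the dimension of the kernel of the pencil at $s=\mu$. *)

(* Defs.v *)
From HB Require Import structures.
From mathcomp Require Import all_boot all_order all_algebra.
From mathcomp Require Import reals complex.

Set Implicit Arguments.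
Unset Strict Implicit.
Unset Printing Implicit Defensive.

Import Order.TTheory GRing.Theory Num.Theory.
Local Open Scope ring_scope.

Definition psdmx (R : realType) (N : nat) (P : 'M[R]_N) : Prop :=
  P^T = P /\ forall x : 'cV[R]_N, 0 <= (x^T *m P *m x) 0 0.

(* Loewner order. *)
Definition lemx (R : realType) (N : nat) (P Q : 'M[R]_N) : Prop :=
  psdmx (Q - P).

Definition toCmx (R : realType) (p q : nat) (M : 'M[R]_(p, q)) : 'M[R[i]]_(p, q) :=
  map_mx (real_complex R) M.

Definition toPmx (R : realType) (p q : nat) (M : 'M[R]_(p, q)) :
  'M[{poly R}]_(p, q) := map_mx polyC M.

Definition toFmx (R : realType) (p q : nat) (M : 'M[R]_(p, q)) :
  'M[{fraction {poly R}}]_(p, q) := map_mx (fun c : R => tofrac c%:P) M.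

Definition asymp_stable (R : realType) (N : nat) (A : 'M[R]_N) : Prop :=
  forall z : R[i], eigenvalue (toCmx A) z -> complex.Re z < 0.

Definition stabilizable (R : realType) (N m : nat)
    (A : 'M[R]_N) (B : 'M[R]_(N, m)) : Prop :=
  exists F : 'M[R]_(m, N), asymp_stable (A + B *m F).

(* Kalman matrices [B, A B, ..., A^(N-1) B] and [C; C A; ...; C A^(N-1)]. *)
Definition controllable (R : realType) (N m : nat)
    (A : 'M[R]_N) (B : 'M[R]_(N, m)) : Prop :=
  \rank (\mxrow_(k < N) (A ^+ k *m B)) = N.

Definition observable (R : realType) (N p : nat)
    (A : 'M[R]_N) (C : 'M[R]_(p, N)) : Prop :=
  \rank (\mxcol_(k < N) (C *m A ^+ k)) = N.

Definition minimal_system (R : realType) (N m p : nat)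
    (A : 'M[R]_N) (B : 'M[R]_(N, m)) (C : 'M[R]_(p, N)) : Prop :=
  controllable A B /\ observable A C.

Definition transfer (R : realType) (N m p : nat) (A : 'M[R]_N)
    (B : 'M[R]_(N, m)) (C : 'M[R]_(p, N)) (D : 'M[R]_(p, m)) :
    'M[{fraction {poly R}}]_(p, m) :=
  toFmx C *m invmx ((tofrac 'X)%:M - toFmx A) *m toFmx B + toFmx D.

Definition pencil (K : nzRingType) (N m p : nat) (s : K) (A : 'M[K]_N)
    (B : 'M[K]_(N, m)) (C : 'M[K]_(p, N)) (D : 'M[K]_(p, m)) :
    'M[K]_(N + p, N + m) :=
  block_mx (- s%:M + A) B C D.

Definition is_zero (R : realType) (N m p : nat) (A : 'M[R]_N)
    (B : 'M[R]_(N, m)) (C : 'M[R]_(p, N)) (D : 'M[R]_(p, m))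
    (mu : R[i]) : Prop :=
  (\rank (pencil mu (toCmx A) (toCmx B) (toCmx C) (toCmx D))
   < \rank (pencil (tofrac 'X) (toFmx A) (toFmx B) (toFmx C) (toFmx D)))%N.

(* Meaningful only if the determinant of the pencil is not identically zero,
   i.e. if the (square) transfer function is invertible. The transpose is there
   because [kermx] is the left kernel. *)
Definition semisimple_zero (R : realType) (N m : nat) (A : 'M[R]_N)
    (B : 'M[R]_(N, m)) (C : 'M[R]_(m, N)) (D : 'M[R]_m) (mu : R[i]) : Prop :=
  mup mu (map_poly (real_complex R)
            (\det (pencil 'X (toPmx A) (toPmx B) (toPmx C) (toPmx D))))
  = \rank (kermx (pencil mu (toCmx A) (toCmx B) (toCmx C) (toCmx D))^T).

Definition has_semisimple_zeros (R : realType) (N m : nat) (A : 'M[R]_N)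
    (B : 'M[R]_(N, m)) (C : 'M[R]_(m, N)) (D : 'M[R]_m) : Prop :=
  forall mu : R[i], is_zero A B C D mu -> semisimple_zero A B C D mu.

Definition kyp_mx (R : realType) (N m : nat) (A : 'M[R]_N)
    (B : 'M[R]_(N, m)) (C : 'M[R]_(m, N)) (D : 'M[R]_m) (P : 'M[R]_N) :
    'M[R]_(N + m) :=
  block_mx (A^T *m P + P *m A) (P *m B - C^T) (B^T *m P - C) (- D - D^T).

Definition psd_kyp_solution (R : realType) (N m : nat) (A : 'M[R]_N)
    (B : 'M[R]_(N, m)) (C : 'M[R]_(m, N)) (D : 'M[R]_m) (P : 'M[R]_N) : Prop :=
  psdmx P /\ lemx (kyp_mx A B C D P) 0.

Definition minimal_kyp_solution (R : realType) (N m : nat) (A : 'M[R]_N)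
    (B : 'M[R]_(N, m)) (C : 'M[R]_(m, N)) (D : 'M[R]_m) (P : 'M[R]_N) : Prop :=
  psd_kyp_solution A B C D P /\
  forall P' : 'M[R]_N, psd_kyp_solution A B C D P' -> lemx P P'.

(* The order of the diagonal entries is not prescribed: [blk i] tells which of
   the distinct values [sigma k] is the i-th diagonal entry, and the
   multiplicity of [sigma k] is the size of the fibre of [blk] over [k], which
   need not consist of consecutive indices. *)
Definition positive_real_balanced (R : realType) (N m : nat) (A : 'M[R]_N)
    (B : 'M[R]_(N, m)) (C : 'M[R]_(m, N)) (D : 'M[R]_m) : Prop :=
  exists (h : nat) (sigma : 'I_h -> R) (blk : 'I_N -> 'I_h),
    let S := diag_mx (\row_i sigma (blk i)) in
    [/\ injective sigma,
        forall k, 0 < sigma k <= 1,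
        minimal_kyp_solution A B C D S
      & minimal_kyp_solution A^T C^T B^T D^T S].

(* The 6 x 6 block matrix, grouped along (m + l) + ((p1 + p2) + (l + m)). *)
Definition bal_A (R : realType) (m l p1 p2 : nat)
    (A16 : 'M[R]_m) (A25 : 'M[R]_l) (A26 : 'M[R]_(l, m))
    (A33 : 'M[R]_p1) (A34 : 'M[R]_(p1, p2)) (A36 : 'M[R]_(p1, m))
    (A44 : 'M[R]_p2) (A46 : 'M[R]_(p2, m)) (A66 : 'M[R]_m) :
    'M[R]_((m + l) + ((p1 + p2) + (l + m))) :=
  let A_12_56 := block_mx 0   A16
                          A25 A26 in
  let A_34_34 := block_mx A33      A34
                          (- A34^T) A44 in
  let A_34_56 := block_mx 0 A36
                          0 A46 in
  let A_56_12 := block_mx 0         (- A25^T)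
                          (- A16^T) (- A26^T) in
  let A_56_34 := block_mx 0         0
                          (- A36^T) A46^T in
  let A_56_56 := block_mx 0 0
                          0 A66 in
  block_mx 0                  (row_mx 0 A_12_56)
           (col_mx 0 A_56_12) (block_mx A_34_34 A_34_56
                                        A_56_34 A_56_56).

Definition bal_B (R : realType) (m l p1 p2 : nat) (B6 : 'M[R]_m) :
    'M[R]_((m + l) + ((p1 + p2) + (l + m)), m) :=
  col_mx 0 (col_mx 0 (col_mx 0 B6)).

Definition bal_P (R : realType) (m l p1 p2 : nat) (Pi : 'M[R]_(p1 + p2)) :
    'M[R]_((m + l) + ((p1 + p2) + (l + m))) :=
  block_mx 1%:M 0
           0    (block_mx Pi 0
                          0  1%:M).

(* Main.v *)
Require Import Defs.
From HB Require Import structures.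
From mathcomp Require Import all_boot all_order all_algebra.
From mathcomp Require Import reals complex ring lra.
From mathcomp Require Import boolp classical_sets topology normedtype sequences.

(** The system is passive with the energy [x^T x / 2], has collocated input and
output, and is symmetric with respect to the signature [S = diag(-1, 1)].
Restriction to the reachable states, and then to the orthogonal complement of
the radical of [S], gives a minimal realization with the same properties, in
which [S] is a nonsingular symmetric matrix ([collocated_reach],
[collocated_nondegenerate]).

Since there is no feedthrough, every solution of the KYP inequality satisfies
[P B = C^T], which fixes the energy on the range of [B]. What remains on the
orthogonal complement is the KYP inequality of the inverse system without its
polynomial part ([kyp_strip]). The generator of that system, the zero dynamics,
is dissipative, hence an orthogonal direct sum of a skew matrix [J] and a damped
matrix [Az] ([dissipative_split]). The Sylvester equation between a damped and a
skew matrix has only the zero solution ([damped_skew_sylvester]), so every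
solution is block diagonal, and reachability makes it the identity on the
conservative part ([kyp_split]). So the solutions of the whole inequality are
the matrices [diag(1, Pz, 1)], where [Pz] runs through the solutions for the
damped part, and minimal solutions correspond to minimal solutions.

The block pattern comes from [S]. On the conservative part [S] is an involution
that anticommutes with [J], so that [J] is off-diagonal with respect to the
eigenspaces of [S]. Reachability bounds the dimension of [ker J] by the number
[m] of inputs, and the fact that the transfer function vanishes at [0], in the
form of an equilibrium without output for each constant input, bounds it from
below ([conservative_blocks]). On the damped part [S] and the minimal solution
are diagonalized together ([balance_forms]); as [S] then becomes a signature that
exchanges the system with its dual, the dual minimal solution is the same diagonal
matrix, and since its inverse solves the primal inequality its entries are at
most [1].

A minimal solution exists because value iteration for the available storage,
carried out after a Cayley transform, increases to it ([minimal_kyp_exists]).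
Finally the system pencil reduces to that of the zero dynamics
([canon_is_zero]): the zeros are the eigenvalues of [J], which are imaginary, and
those of [Az], which have negative real part. *)

Set Implicit Arguments.
Unset Strict Implicit.
Unset Printing Implicit Defensive.

Import Order.TTheory GRing.Theory Num.Theory.
Import numFieldNormedType.Exports.
Local Open Scope ring_scope.

(** * Euclidean forms and orthogonal splittings *)

Lemma eq_mulmx_cV (K : pzSemiRingType) (p q : nat) (M M' : 'M[K]_(p, q)) :
  (forall x : 'cV_q, M *m x = M' *m x) -> M = M'.
Proof.
by move=> h; apply/matrixP=> i j; have /matrixP/(_ i 0) := h (delta_mx j 0);
   rewrite -!colE !mxE.
Qed.

Lemma expmxS (K : pzSemiRingType) (N : nat) (A : 'M[K]_N) k :
  A ^+ k.+1 = A *m A ^+ k.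
Proof. exact: exprS. Qed.

Lemma expmxSr (K : pzSemiRingType) (N : nat) (A : 'M[K]_N) k :
  A ^+ k.+1 = A ^+ k *m A.
Proof. exact: exprSr. Qed.

Lemma trmx_exp (K : comPzSemiRingType) (N : nat) (A : 'M[K]_N) k :
  (A ^+ k)^T = A^T ^+ k.
Proof.
elim: k => [|k IH]; first by rewrite !expr0 trmx1.
by rewrite expmxS trmx_mul IH -expmxSr.
Qed.

Lemma intertwine_exp (K : pzSemiRingType) (N N' : nat) (A : 'M[K]_N)
    (A' : 'M[K]_N') (X : 'M_(N, N')) k :
  A *m X = X *m A' -> A ^+ k *m X = X *m A' ^+ k.
Proof.
move=> h; elim: k => [|k IH]; first by rewrite !expr0 mul1mx mulmx1.
by rewrite expmxSr -mulmxA h mulmxA IH -mulmxA -expmxSr.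
Qed.

(** The dimensions below are ranks, which are equal by a proof only and not by
conversion. *)
Lemma left_inv_right_inv (F : fieldType) (p q : nat) (X : 'M[F]_(p, q))
    (Y : 'M_(q, p)) : p = q -> X *m Y = 1%:M -> Y *m X = 1%:M.
Proof. by move=> e; subst q => /mulmx1C. Qed.

Section RealForms.
Variable R : realType.

Definition dot (p : nat) (x y : 'cV[R]_p) : R := (x^T *m y) 0 0.

Lemma dotE p (x y : 'cV[R]_p) : dot x y = \sum_i x i 0 * y i 0.
Proof. by rewrite /dot mxE; apply: eq_bigr => i _; rewrite mxE. Qed.

Lemma dotC p (x y : 'cV[R]_p) : dot x y = dot y x.
Proof. by rewrite !dotE; apply: eq_bigr => i _; rewrite mulrC. Qed.

Lemma dotDr p (x y z : 'cV[R]_p) : dot x (y + z) = dot x y + dot x z.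
Proof. by rewrite /dot mulmxDr mxE. Qed.

Lemma dotDl p (x y z : 'cV[R]_p) : dot (x + y) z = dot x z + dot y z.
Proof. by rewrite !(dotC _ z) dotDr. Qed.

Lemma dotNr p (x y : 'cV[R]_p) : dot x (- y) = - dot x y.
Proof. by rewrite /dot mulmxN mxE. Qed.

Lemma dotNl p (x y : 'cV[R]_p) : dot (- x) y = - dot x y.
Proof. by rewrite dotC dotNr dotC. Qed.

Lemma dotBr p (x y z : 'cV[R]_p) : dot x (y - z) = dot x y - dot x z.
Proof. by rewrite dotDr dotNr. Qed.

Lemma dotBl p (x y z : 'cV[R]_p) : dot (x - y) z = dot x z - dot y z.
Proof. by rewrite dotDl dotNl. Qed.

Lemma dotZr p (x y : 'cV[R]_p) c : dot x (c *: y) = c * dot x y.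
Proof. by rewrite /dot -scalemxAr mxE. Qed.

Lemma dotZl p (x y : 'cV[R]_p) c : dot (c *: x) y = c * dot x y.
Proof. by rewrite dotC dotZr dotC. Qed.

Lemma dot0r p (x : 'cV[R]_p) : dot x 0 = 0.
Proof. by rewrite /dot mulmx0 mxE. Qed.

Lemma dot0l p (x : 'cV[R]_p) : dot 0 x = 0.
Proof. by rewrite dotC dot0r. Qed.

Lemma dot_adj p q (M : 'M[R]_(p, q)) x y : dot x (M *m y) = dot (M^T *m x) y.
Proof. by rewrite /dot trmx_mul trmxK mulmxA. Qed.

Lemma dot_ge0 p (x : 'cV[R]_p) : 0 <= dot x x.
Proof. by rewrite dotE sumr_ge0 // => i _; rewrite -expr2 sqr_ge0. Qed.

Lemma dot_eq0 p (x : 'cV[R]_p) : dot x x = 0 -> x = 0.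
Proof.
move=> h; apply/matrixP=> i j; rewrite (ord1 j) mxE.
have := h; rewrite dotE => /eqP.
rewrite psumr_eq0; last by move=> k _; rewrite -expr2 sqr_ge0.
by move=> /allP/(_ i (mem_index_enum _)) /=; rewrite mulf_eq0 orbb => /eqP.
Qed.

Lemma dot_gt0 p (x : 'cV[R]_p) : x != 0 -> 0 < dot x x.
Proof.
move=> xN0; rewrite lt_def dot_ge0 andbT.
by apply: contra xN0 => /eqP/dot_eq0->.
Qed.

Lemma dot_col_mx p q (x x' : 'cV[R]_p) (y y' : 'cV[R]_q) :
  dot (col_mx x y) (col_mx x' y') = dot x x' + dot y y'.
Proof. by rewrite /dot tr_col_mx mul_row_col mxE. Qed.

Lemma psdmxP p (P : 'M[R]_p) :
  psdmx P <-> P^T = P /\ forall x, 0 <= dot x (P *m x).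
Proof.
by split=> -[h1 h2]; split=> // x; have := h2 x; rewrite /dot mulmxA.
Qed.

Lemma lemxP p (P Q : 'M[R]_p) : P^T = P -> Q^T = Q ->
  (lemx P Q <-> forall x, dot x (P *m x) <= dot x (Q *m x)).
Proof.
move=> sP sQ; rewrite /lemx psdmxP linearB /= sP sQ; split=> [[_ h]|h].
  by move=> x; have := h x; rewrite mulmxBl dotBr subr_ge0.
by split=> // x; rewrite mulmxBl dotBr subr_ge0.
Qed.

(** A quadratic polynomial [c t + b t^2] that is nonnegative for all [t] has
[c = 0]; with [y = P x] this is the Cauchy-Schwarz argument. *)
Lemma psd_isotropic p (P : 'M[R]_p) x :
  psdmx P -> dot x (P *m x) = 0 -> P *m x = 0.
Proof.
move=> /psdmxP[sP hP] h0; apply: dot_eq0.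
set y := P *m x; set c := dot y y; set b := dot y (P *m y).
have b0 : 0 <= b by apply: hP.
have c0 : 0 <= c by apply: dot_ge0.
have := hP (x - (c / (b + 1)) *: y).
rewrite mulmxBr -scalemxAr dotBr !dotBl !dotZl !dotZr h0 -/b.
rewrite (dot_adj P x) sP -/y -/c.
set t := c / (b + 1).
have tE : t * (b + 1) = c by rewrite /t mulfVK // gt_eqF // ltr_wpDl.
nra.
Qed.

Definition spdmx p (P : 'M[R]_p) : Prop :=
  P^T = P /\ forall x, x != 0 -> 0 < dot x (P *m x).

Lemma spd_psd p (P : 'M[R]_p) : spdmx P -> psdmx P.
Proof.
move=> [sP hP]; apply/psdmxP; split=> // x.
by have [->|/hP/ltW//] := eqVneq x 0; rewrite mulmx0 dot0r.
Qed.

Lemma psd_spd p (P : 'M[R]_p) :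
  psdmx P -> (forall x : 'cV_p, P *m x = 0 -> x = 0) -> spdmx P.
Proof.
move=> hP inj; have [sP hP'] := (psdmxP P).1 hP; split=> // x xN0.
rewrite lt_def hP' andbT; apply: contra xN0 => /eqP h.
by apply/eqP/inj/psd_isotropic.
Qed.

Lemma col_inj_row_free p q (M : 'M[R]_(p, q)) :
  (forall x : 'cV_q, M *m x = 0 -> x = 0) -> row_free M^T.
Proof.
move=> h; rewrite -kermx_eq0; apply/eqP/row_matrixP=> i.
rewrite row0; apply: trmx_inj; rewrite trmx0; apply: h.
by rewrite -[LHS]trmxK trmx_mul trmxK -row_mul mulmx_ker row0 trmx0.
Qed.

Lemma unitmx_inj p (M : 'M[R]_p) :
  (forall x : 'cV_p, M *m x = 0 -> x = 0) -> M \in unitmx.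
Proof. by move=> /col_inj_row_free; rewrite row_free_unit unitmx_tr. Qed.

Lemma spd_unit p (P : 'M[R]_p) : spdmx P -> P \in unitmx.
Proof.
move=> [_ h]; apply: unitmx_inj => x hx.
have [//|/h] := eqVneq x 0; by rewrite hx dot0r ltxx.
Qed.

Lemma spd_inv p (P : 'M[R]_p) : spdmx P -> spdmx (invmx P).
Proof.
move=> hP; have uP := spd_unit hP; have [sP h] := hP.
split=> [|x xN0]; first by rewrite trmx_inv sP.
have -> : x = P *m (invmx P *m x) by rewrite mulKVmx.
rewrite mulKmx // dotC; apply: h; apply: contra xN0 => /eqP e.
by rewrite -(mulKVmx uP x) e mulmx0.
Qed.

Lemma spd_congr_inj p q (P : 'M[R]_p) (T : 'M_(p, q)) : spdmx P ->
  (forall x : 'cV_q, T *m x = 0 -> x = 0) -> spdmx (T^T *m P *m T).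
Proof.
move=> [sP h] inj; split=> [|x xN0].
  by rewrite !trmx_mul trmxK sP mulmxA.
rewrite -!mulmxA dot_adj trmxK; apply: h; apply: contra xN0 => /eqP e.
by apply/eqP/inj.
Qed.

Lemma psd_congr p q (P : 'M[R]_p) (T : 'M_(p, q)) :
  psdmx P -> psdmx (T^T *m P *m T).
Proof.
move=> /psdmxP[sP h]; apply/psdmxP; split=> [|x].
  by rewrite !trmx_mul trmxK sP mulmxA.
by rewrite -!mulmxA dot_adj trmxK.
Qed.

Lemma spd_block p q (P : 'M[R]_p) (Q : 'M_q) (X : 'M_(p, q)) (Y : 'M_(q, p)) :
  spdmx (block_mx P X Y Q) -> spdmx P /\ spdmx Q.
Proof.
move=> [s h]; move: s; rewrite tr_block_mx => /eq_block_mx[sP _ _ sQ].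
split; split=> // x xN0.
  have := h (col_mx x 0); rewrite col_mx_eq0 eqxx andbT => /(_ xN0).
  by rewrite mul_block_col !mulmx0 !addr0 dot_col_mx dot0l addr0.
have := h (col_mx 0 x); rewrite col_mx_eq0 eqxx andTb => /(_ xN0).
by rewrite mul_block_col !mulmx0 !add0r dot_col_mx dot0l add0r.
Qed.

(** Cholesky: after elimination of the first variable the Schur complement is
again positive definite. *)
Lemma spd_congr1 p (P : 'M[R]_p) : spdmx P ->
  exists2 T : 'M_p, T \in unitmx & T^T *m P *m T = 1%:M.
Proof.
elim: p P => [|p IH] P; first by exists 1%:M;
  [rewrite unitmx1 | rewrite flatmx0 [RHS]flatmx0].
move: P; rewrite -[p.+1]/(1 + p)%N => P hP.
pose a := ulsubmx P; pose b := ursubmx P; pose P' := drsubmx P.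
have PE : P = block_mx a b b^T P'.
  by rewrite -[LHS]submxK -[dlsubmx P]trmxK trmx_dlsub hP.1.
have [[sa ha] _] : spdmx a /\ spdmx P' 
  by move: hP; rewrite {1}PE => /spd_block.
set s := a 0 0.
have aE : a = s%:M by apply: mx11_scalar.
have s0 : 0 < s.
  have := ha 1%:M; rewrite mulmx1 /dot trmx1 mul1mx; apply.
  by rewrite -[1%:M]/(1 : 'M_1) oner_eq0.
have sN0 : s != 0 by rewrite gt_eqF.
pose L : 'M_(1 + p) := block_mx 1%:M (- s^-1 *: b) 0 1%:M.
have uL : L \in unitmx by rewrite unitmxE det_ublock !det1 mulr1 unitr1.
have LPL : L^T *m P *m L = block_mx a 0 0 (P' - s^-1 *: (b^T *m b)).
  rewrite PE /L tr_block_mx trmx0 !trmx1 linearZ /= !mulmx_block.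
  rewrite !mul1mx !mul0mx !mulmx1 !mulmx0 !addr0 aE !mul_scalar_mx.
  rewrite mul_mx_scalar !scalerA mulrN divff // !scaleN1r !addNr mul0mx add0r.
  by rewrite -scalemxAl scaleNr [- _ + _]addrC.
have hL : spdmx (L^T *m P *m L).
  apply: spd_congr_inj hP _ => x hx.
  by rewrite -(mulKmx uL x) hx mulmx0.
move: hL; rewrite LPL => /spd_block[_ /IH[T' uT' hT']].
have r0 : Num.sqrt s * Num.sqrt s = s by rewrite -expr2 sqr_sqrtr // ltW.
have rN0 : Num.sqrt s != 0 by rewrite gt_eqF // sqrtr_gt0.
pose W : 'M_(1 + p) := block_mx (Num.sqrt s)^-1%:M 0 0 T'.
exists (L *m W).
  rewrite unitmx_mul uL /W unitmxE det_ublock det_scalar1 unitrM.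
  by rewrite unitfE invr_neq0 //= -unitmxE.
rewrite trmx_mul -!mulmxA (mulmxA P) (mulmxA L^T) (mulmxA L^T) LPL.
rewrite /W tr_block_mx !trmx0 tr_scalar_mx !mulmx_block.
rewrite !mul0mx !mulmx0 !addr0 !add0r ?mul0mx ?mulmx0 ?addr0 ?add0r.
rewrite -!mulmxA in hT' *; rewrite hT' aE -!scalar_mxM [RHS]scalar_mx_block.
congr (block_mx _%:M _ _ _).
by rewrite -{2}r0; field.
Qed.

(** The splittings of the state space are all orthogonal, because the stored
energy [x^T x] then splits as well. [U1] spans the range of [M] and [U0] its
orthogonal complement. *)
Lemma orth_split N q (M : 'M[R]_(N, q)) :
  exists k r (U0 : 'M[R]_(N, k)) (U1 : 'M[R]_(N, r)),
  [/\ [/\ U0^T *m U0 = 1%:M, U1^T *m U1 = 1%:M, U0^T *m U1 = 0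
        & U0 *m U0^T + U1 *m U1^T = 1%:M],
      (k + r = N)%N, U0^T *m M = 0 & exists L, U1 = M *m L].
Proof.
have norm k (X : 'M[R]_(k, N)) : row_free X ->
    exists T : 'M_k, (X^T *m T)^T *m (X^T *m T) = 1%:M.
  move=> fX.
  have : spdmx ((X^T)^T *m 1%:M *m X^T).
    apply: spd_congr_inj => [|x hx].
      by split=> [|x xN0]; [rewrite trmx1 | rewrite mul1mx dot_gt0].
    apply: trmx_inj; apply: (row_free_inj fX).
    by rewrite trmx0 mul0mx -[X]trmxK -trmx_mul hx trmx0.
  move=> /spd_congr1[T _ hT]; exists T.
  by rewrite -hT mulmx1 trmx_mul !mulmxA.
have [T1 h1] := norm _ _ (row_base_free M^T).
have [T0 h0] := norm _ _ (row_base_free (kermx M)).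
set U0 := (row_base (kermx M))^T *m T0 in h0.
set U1 := (row_base M^T)^T *m T1 in h1.
have U0M : U0^T *m M = 0.
  rewrite /U0 trmx_mul trmxK -mulmxA.
  have /sub_kermxP-> : (row_base (kermx M) <= kermx M)%MS by rewrite eq_row_base.
  by rewrite mulmx0.
have [L hL] : exists L, U1 = M *m L.
  have /submxP[L' e] : (row_base M^T <= M^T)%MS by rewrite eq_row_base.
  by exists (L'^T *m T1); rewrite /U1 e trmx_mul trmxK mulmxA.
have U01 : U0^T *m U1 = 0 by rewrite hL mulmxA U0M mul0mx.
have eN : (\rank (kermx M) + \rank M^T = N)%N.
  by rewrite mxrank_ker mxrank_tr subnK // rank_leq_row.
exists _, _, U0, U1; split=> //; last by exists L.
split=> //.
have : (row_mx U0 U1)^T *m row_mx U0 U1 = 1%:M.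
  rewrite tr_row_mx mul_col_row h0 h1 U01 -[U1^T *m U0]trmxK trmx_mul trmxK U01.
  by rewrite trmx0 -scalar_mx_block.
by move/(left_inv_right_inv eN); rewrite tr_row_mx mul_row_col.
Qed.

End RealForms.

(** * Krylov spaces, eigenvectors and the spectral theorem *)

(** Cayley-Hamilton: reduce [X^k] modulo the characteristic polynomial. *)
Lemma expmx_lin_comb (F : fieldType) (N : nat) (A : 'M[F]_N) (k : nat) :
  exists c : 'I_N -> F, A ^+ k = \sum_(i < N) c i *: A ^+ i.
Proof.
case: N A => [|N] A; first by exists (fun=> 0); rewrite flatmx0 [RHS]flatmx0.
pose p := char_poly A; pose r := 'X^k %% p.
have pN0 : p != 0 by rewrite -size_poly_eq0 size_char_poly.
exists (fun i => r`_i).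
have -> : A ^+ k = horner_mx A r.
  have := horner_mx_X A => e; rewrite -{1}e -rmorphXn /=.
  rewrite {1}(divp_eq 'X^k p) rmorphD rmorphM /= Cayley_Hamilton.
  by rewrite mulr0 add0r.
rewrite /horner_mx /= /horner_morph (@horner_coef_wide _ N.+1); last first.
  apply: leq_trans (size_poly _ _) _.
  by rewrite -ltnS -(size_char_poly A) ltn_modp.
apply: eq_bigr => i _; rewrite coef_map_id0 ?raddf0 //.
by rewrite -mul_scalar_mx.
Qed.

Lemma krylov_left_zero (F : fieldType) (N p q : nat) (A : 'M[F]_N)
    (B : 'M_(N, q)) (W : 'M_(p, N)) :
  (forall k : 'I_N, W *m A ^+ k *m B = 0) -> forall k, W *m A ^+ k *m B = 0.
Proof.
move=> h k; have [c ->] := expmx_lin_comb A k.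
rewrite mulmx_sumr mulmx_suml big1 // => i _.
by rewrite -scalemxAr -scalemxAl h scaler0.
Qed.

(** The Kalman rank condition in dual form. Without a bound on [k] it passes
along intertwining maps between spaces of different dimensions. *)
Definition reachable (F : fieldType) (N q : nat) (A : 'M[F]_N)
    (B : 'M[F]_(N, q)) : Prop :=
  forall v : 'rV_N, (forall k, v *m A ^+ k *m B = 0) -> v = 0.

Lemma mul_mxrow_eq0 (F : fieldType) (N p q n : nat) (W : 'M[F]_(p, N))
    (M : 'I_n -> 'M[F]_(N, q)) :
  W *m \mxrow_k M k = 0 <-> forall k, W *m M k = 0.
Proof.
rewrite mul_mxrow -(@mxrow0 F n (fun=> q) p); split=> [/eq_mxrowP //|h].
exact/eq_mxrowP.
Qed.

Lemma reachable_controllable (R : realType) (N q : nat) (A : 'M[R]_N)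
    (B : 'M[R]_(N, q)) : reachable A B -> controllable A B.
Proof.
move=> h; apply/eqP; rewrite -/(row_free _) -kermx_eq0; apply/eqP/row_matrixP=> i.
rewrite row0; apply: h; apply: krylov_left_zero => k.
set M := \mxrow_k _; have : row i (kermx M) *m M = 0.
  by rewrite -row_mul mulmx_ker row0.
by move=> /(mul_mxrow_eq0 _ (fun j : 'I_N => A ^+ j *m B)).1/(_ k); rewrite mulmxA.
Qed.

Lemma reachable_observable (R : realType) (N q : nat) (A : 'M[R]_N)
    (C : 'M[R]_(q, N)) : reachable A^T C^T -> observable A C.
Proof.
move=> /reachable_controllable; rewrite /controllable /observable.
move=> h; rewrite -[RHS]h -mxrank_tr tr_mxcol; congr (\rank _); apply: eq_mxrow => k.
by rewrite trmx_mul trmx_exp.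
Qed.

(** By Cayley-Hamilton the Krylov space of [A] and [B] is already spanned by the
first [N] blocks, hence it is invariant. [U1] spans it, and [U0] its orthogonal
complement; no smaller invariant subspace contains the range of [B], which is
what the last clause says. *)
Lemma krylov_split (R : realType) N q (A : 'M[R]_N) (B : 'M[R]_(N, q)) :
  exists k r (U0 : 'M[R]_(N, k)) (U1 : 'M[R]_(N, r)),
  [/\ [/\ U0^T *m U0 = 1%:M, U1^T *m U1 = 1%:M, U0^T *m U1 = 0
        & U0 *m U0^T + U1 *m U1^T = 1%:M],
      forall j, U0^T *m A ^+ j *m B = 0,
      A *m U1 = U1 *m (U1^T *m A *m U1),
      B = U1 *m (U1^T *m B)
    & forall v : 'rV_N, (forall j, v *m A ^+ j *m B = 0) -> v *m U1 = 0].
Proof.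
have [k [r [U0 [U1 [o _ U0M [L hL]]]]]] :=
  orth_split (\mxrow_(j < N) (A ^+ j *m B)).
have z j : U0^T *m A ^+ j *m B = 0.
  apply: krylov_left_zero => {}j; rewrite -mulmxA.
  exact: (mul_mxrow_eq0 U0^T (fun j : 'I_N => A ^+ j *m B)).1.
have [_ _ _ id1] := o.
have proj p (X : 'M_(N, p)) : U0^T *m X = 0 -> X = U1 *m (U1^T *m X).
  by move=> h; rewrite -{1}[X]mul1mx -id1 mulmxDl -!mulmxA h mulmx0 add0r.
exists k, r, U0, U1; split=> //.
- rewrite -mulmxA; apply: proj; rewrite hL 2!mulmxA.
  suff -> : U0^T *m A *m \mxrow_(j < N) (A ^+ j *m B) = 0 by rewrite mul0mx.
  apply/(mul_mxrow_eq0 _ (fun j : 'I_N => A ^+ j *m B)) => j.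
  by rewrite -mulmxA (mulmxA A) -expmxS mulmxA z.
- by apply: proj; have := z 0; rewrite expr0 mulmx1.
- move=> v hv; rewrite hL mulmxA.
  suff -> : v *m \mxrow_(j < N) (A ^+ j *m B) = 0 by rewrite mul0mx.
  by apply/(mul_mxrow_eq0 _ (fun j : 'I_N => A ^+ j *m B)) => j; rewrite mulmxA.
Qed.

Section Complexify.
Variable R : realType.

Lemma Re_sum (I : finType) (f : I -> R[i]) :
  complex.Re (\sum_i f i) = \sum_i complex.Re (f i).
Proof. by apply: (big_morph (@complex.Re R)) => // -[a b] [c d]. Qed.

Lemma Im_sum (I : finType) (f : I -> R[i]) :
  complex.Im (\sum_i f i) = \sum_i complex.Im (f i).
Proof. by apply: (big_morph (@complex.Im R)) => // -[a b] [c d]. Qed.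

(** Splitting an eigenvector into [a + i b] lets the energy estimates below work
with real inner products only. *)
Lemma eigenvalue_realP (N : nat) (A : 'M[R]_N) (z : R[i]) :
  eigenvalue (toCmx A) z <->
  exists a b : 'rV[R]_N, [/\ (a != 0) || (b != 0),
    a *m A = complex.Re z *: a - complex.Im z *: b
  & b *m A = complex.Im z *: a + complex.Re z *: b].
Proof.
case: z => x y /=; split.
  move=> /eigenvalueP[v hv vN0].
  exists (map_mx (@complex.Re R) v), (map_mx (@complex.Im R) v); split.
  - apply: contraNT vN0; rewrite negb_or !negbK => /andP[/eqP ha /eqP hb].
    apply/eqP/rowP=> j; have /rowP/(_ j) := ha; have /rowP/(_ j) := hb.
    by rewrite !mxE; case: (v 0 j) => c d /= -> ->.
  - apply/rowP=> j; have /rowP/(_ j)/(congr1 (@complex.Re R)) := hv.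
    rewrite !mxE Re_sum; case: (v 0 j) => c d /= <-; apply: eq_bigr => k _.
    by rewrite !mxE; case: (v 0 k) => e f /=; rewrite mulr0 subr0.
  - apply/rowP=> j; have /rowP/(_ j)/(congr1 (@complex.Im R)) := hv.
    rewrite !mxE Im_sum; case: (v 0 j) => c d /=; rewrite [RHS]addrC => <-.
    apply: eq_bigr => k _.
    by rewrite !mxE; case: (v 0 k) => e f /=; rewrite mulr0 add0r.
move=> [a [b [nz ha hb]]]; apply/eigenvalueP.
exists (\row_j Complex (a 0 j) (b 0 j)).
  apply/rowP=> j; rewrite !mxE; apply/eqP; rewrite eq_complex; apply/andP; split.
    have /rowP/(_ j) := ha; rewrite !mxE Re_sum /= => <-; apply/eqP.
    by apply: eq_bigr => k _; rewrite !mxE /= mulr0 subr0.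
  have /rowP/(_ j) := hb; rewrite !mxE Im_sum /= [RHS]addrC => h; apply/eqP.
  rewrite -h.
  by apply: eq_bigr => k _; rewrite !mxE /= mulr0 add0r.
apply: contraTneq nz => e; rewrite negb_or !negbK; apply/andP; split.
  by apply/eqP/rowP=> j; have /rowP/(_ j)/(congr1 (@complex.Re R)) := e; rewrite !mxE.
by apply/eqP/rowP=> j; have /rowP/(_ j)/(congr1 (@complex.Im R)) := e; rewrite !mxE.
Qed.

Lemma eigenvalue_exists (N : nat) (A : 'M[R]_N) : (0 < N)%N ->
  exists z, eigenvalue (toCmx A) z.
Proof.
move=> N0.
have /closed_rootP[z hz] : size (char_poly (toCmx A)) != 1%N.
  by rewrite size_char_poly eqSS -lt0n.
by exists z; rewrite eigenvalue_root_char.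
Qed.

(** For a complex eigenvalue [al + i be] of a symmetric matrix with eigenvector
[a + i b], the two ways to compute [a^T S b] give [be (|a|^2 + |b|^2) = 0]. *)
Lemma sym_eigenvector (N : nat) (S : 'M[R]_N) : (0 < N)%N -> S^T = S ->
  exists c (x : 'cV[R]_N), x != 0 /\ S *m x = c *: x.
Proof.
move=> N0 sS; have [z /eigenvalue_realP[a [b [nz ha hb]]]] := eigenvalue_exists S N0.
set al := complex.Re z in ha hb; set be := complex.Im z in ha hb.
have ha' : S *m a^T = al *: a^T - be *: b^T.
  by apply: trmx_inj; rewrite trmx_mul trmxK sS ha !linearB /= !linearZ /= !trmxK.
have hb' : S *m b^T = be *: a^T + al *: b^T.
  by apply: trmx_inj; rewrite trmx_mul trmxK sS hb !linearD /= !linearZ /= !trmxK.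
have na := dot_ge0 a^T; have nb := dot_ge0 b^T.
have pos : 0 < dot a^T a^T + dot b^T b^T.
  case/orP: nz => nz.
    by rewrite ltr_pwDl // dot_gt0 // trmx_eq0.
  by rewrite ltr_wpDl // dot_gt0 // trmx_eq0.
have e : be = 0.
  have := dot_adj S a^T b^T; rewrite sS ha' hb' dotDr dotBl !dotZr !dotZl => e.
  have : be * (dot a^T a^T + dot b^T b^T) = 0 by nra.
  by move/eqP; rewrite mulf_eq0 (gt_eqF pos) orbF => /eqP.
move: ha' hb'; rewrite e !scale0r subr0 add0r => ha' hb'.
by case/orP: nz => nz; [exists al, a^T | exists al, b^T]; rewrite trmx_eq0.
Qed.

(** The eigenvalues are sorted by sign, as this gives the signature of a
symmetric system; splitting off eigenspaces by induction on the dimension does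
it without any permutation. *)
Lemma sym_spectral (N : nat) (S : 'M[R]_N) : S^T = S ->
  (forall x : 'cV_N, S *m x = 0 -> x = 0) ->
  exists p1 p2 (T1 : 'M[R]_(N, p1)) (T2 : 'M[R]_(N, p2))
    (d1 : 'rV[R]_p1) (d2 : 'rV[R]_p2),
  [/\ [/\ T1^T *m T1 = 1%:M, T2^T *m T2 = 1%:M, T1^T *m T2 = 0
        & T1 *m T1^T + T2 *m T2^T = 1%:M],
      forall i, 0 < d1 0 i, forall i, 0 < d2 0 i,
      S *m T1 = - (T1 *m diag_mx d1) & S *m T2 = T2 *m diag_mx d2].
Proof.
elim/ltn_ind: N S => -[|N] IH S sS iS.
  exists 0%N, 0%N, 0, 0, 0, 0.
  by split; try (by case); [split|..]; apply/matrixP=> -[].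
have [c [x [xN0 hx]]] := sym_eigenvector (ltn0Sn N) sS.
have cN0 : c != 0.
  by apply: contra xN0 => /eqP c0; apply/eqP/iS; rewrite hx c0 scale0r.
have [k [r [U0 [U1 [[o0 o1 o01 id1] kr U0x [L hL]]]]]] := orth_split x.
have o10 : U1^T *m U0 = 0 by apply: trmx_inj; rewrite trmx_mul trmxK o01 trmx0.
have SU1 : S *m U1 = c *: U1 by rewrite hL mulmxA hx scalemxAl.
have SU0 : S *m U0 = U0 *m (U0^T *m S *m U0).
  rewrite -{1}[S *m U0]mul1mx -id1 mulmxDl -!mulmxA [X in _ + X](_ : _ = 0) ?addr0 //.
  rewrite (mulmxA U1^T S) -[U1^T *m S]trmxK trmx_mul trmxK sS SU1.
  by rewrite linearZ /= -scalemxAl o10 scaler0 mulmx0.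
have ltk : (k < N.+1)%N.
  rewrite -kr -[X in (X < _)%N]addn0 ltn_add2l lt0n.
  apply: contra xN0 => /eqP r0; subst r.
  have : x = U1 *m (U1^T *m x).
    by rewrite -{1}[x]mul1mx -id1 mulmxDl -!mulmxA U0x mulmx0 add0r.
  by rewrite [U1^T *m x]flatmx0 mulmx0 => ->.
have inj0 (y : 'cV_k) : U0 *m y = 0 -> y = 0.
  by move=> h; rewrite -[y]mul1mx -o0 -mulmxA h mulmx0.
have [||p1 [p2 [T1 [T2 [d1 [d2 [[a1 a2 a12 aid] h1 h2 s1 s2]]]]]]] :=
  IH _ ltk (U0^T *m S *m U0).
- by rewrite !trmx_mul trmxK sS mulmxA.
- move=> y hy; apply/inj0/iS; rewrite mulmxA SU0 -mulmxA hy mulmx0 //.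
have ext p q (X : 'M_(k, p)) (Y : 'M_(k, q)) :
    (U0 *m X)^T *m (U0 *m Y) = X^T *m Y.
  by rewrite trmx_mul -mulmxA (mulmxA U0^T) o0 mul1mx.
have e1 p (X : 'M_(k, p)) : U1^T *m (U0 *m X) = 0 by rewrite mulmxA o10 mul0mx.
have e2 p (X : 'M_(k, p)) : (U0 *m X)^T *m U1 = 0.
  by rewrite trmx_mul -mulmxA o01 mulmx0.
have e3 p (X : 'M_(k, p)) : (U0 *m X) *m (U0 *m X)^T = U0 *m (X *m X^T) *m U0^T.
  by rewrite trmx_mul !mulmxA.
have sE p (X Y : 'M_(k, p)) : (U0^T *m S *m U0) *m X = Y ->
    S *m (U0 *m X) = U0 *m Y.
  by move=> <-; rewrite mulmxA SU0 -!mulmxA.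
have dp p (d : 'rV[R]_p) e : (forall i, 0 < d 0 i) -> 0 < e ->
    forall i, 0 < (row_mx d (const_mx e : 'rV_r)) 0 i.
  by move=> hd he i; rewrite mxE; case: split => j; rewrite ?mxE.
have [cneg|cpos] : c < 0 \/ 0 < c by case: ltgtP cN0 => //; [left|right].
- exists (p1 + r)%N, p2, (row_mx (U0 *m T1) U1), (U0 *m T2),
    (row_mx d1 (const_mx (- c))), d2; split=> //.
  + split.
    * by rewrite tr_row_mx mul_col_row o1 ext a1 e1 e2 -scalar_mx_block.
    * by rewrite ext.
    * by rewrite tr_row_mx mul_col_mx ext a12 e1 col_mx0.
    * rewrite tr_row_mx mul_row_col !e3 addrAC -mulmxDl -mulmxDr aid mulmx1.
      exact: id1.
  + by apply: dp => //; rewrite oppr_gt0.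
  + rewrite mul_mx_row diag_mx_row mul_row_block !mulmx0 addr0 add0r.
    rewrite (sE _ _ _ s1) SU1 opp_row_mx mulmxN mulmxA diag_const_mx.
    by rewrite mul_mx_scalar scaleNr opprK.
  + by rewrite (sE _ _ _ s2) mulmxA.
- exists p1, (p2 + r)%N, (U0 *m T1), (row_mx (U0 *m T2) U1),
    d1, (row_mx d2 (const_mx c)); split=> //.
  + split.
    * by rewrite ext.
    * by rewrite tr_row_mx mul_col_row o1 ext a2 e1 e2 -scalar_mx_block.
    * by rewrite mul_mx_row ext a12 e2 row_mx0.
    * by rewrite tr_row_mx mul_row_col !e3 addrA -mulmxDl -mulmxDr aid mulmx1.
  + exact: dp.
  + by rewrite (sE _ _ _ s1) mulmxN mulmxA.
  + rewrite mul_mx_row diag_mx_row mul_row_block !mulmx0 addr0 add0r.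
    by rewrite (sE _ _ _ s2) SU1 mulmxA diag_const_mx mul_mx_scalar.
Qed.

End Complexify.

(** * The KYP inequality as a dissipation inequality *)

Section Limits.
Local Open Scope classical_set_scope.
Variable R : realType.

(** By polarization the convergence of the monotone bounded values of the
quadratic forms entails that of the matrices. *)
Lemma monotone_sym_limit (N : nat) (P : nat -> 'M[R]_N) (Q : 'M[R]_N) :
  (forall j, (P j)^T = P j) ->
  (forall j x, dot x (P j *m x) <= dot x (P j.+1 *m x)) ->
  (forall j x, dot x (P j *m x) <= dot x (Q *m x)) ->
  exists L : 'M[R]_N, [/\ L^T = L,
    forall j x, dot x (P j *m x) <= dot x (L *m x)
  & forall x e, 0 < e -> exists j0, forall j, (j0 <= j)%N ->
      dot x (L *m x) <= dot x (P j *m x) + e].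
Proof.
move=> sP mP bP.
have cvgf x : cvgn (fun j => dot x (P j *m x)).
  apply: nondecreasing_is_cvgn.
    by apply/nondecreasing_seqP => j; apply: mP.
  by exists (dot x (Q *m x)) => _ [j _ <-]; apply: bP.
pose ev i : 'cV[R]_N := delta_mx i 0.
have dotev j a b : dot (ev a) (P j *m ev b) = P j a b.
  by rewrite /dot -colE mxE (bigD1 a) //= !mxE !eqxx mul1r big1 ?addr0 // => i ia;
     rewrite !mxE (negbTE ia) mul0r.
have polar j a b : P j a b = 2^-1 * (dot (ev a + ev b) (P j *m (ev a + ev b))
    - dot (ev a) (P j *m ev a) - dot (ev b) (P j *m ev b)).
  rewrite mulmxDr dotDl !dotDr !dotev.
  have -> : P j b a = P j a b by rewrite -{1}sP mxE.
  by field.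
have cvgE a b : cvgn (fun j => P j a b).
  rewrite (_ : (fun j => _) = (fun j => 2^-1 *
    (dot (ev a + ev b) (P j *m (ev a + ev b))
    - dot (ev a) (P j *m ev a) - dot (ev b) (P j *m ev b)))); last first.
    by apply/funext => j; rewrite -polar.
  by apply: is_cvgM; [apply: is_cvg_cst | apply: is_cvgB => //; apply: is_cvgB].
pose L : 'M[R]_N := \matrix_(a, b) limn (fun j => P j a b).
have fE (M : 'M[R]_N) x : dot x (M *m x) = \sum_a \sum_b x a 0 * (M a b * x b 0).
  by rewrite dotE; apply: eq_bigr => a _; rewrite mxE mulr_sumr.
have cvgL x : (fun j => dot x (P j *m x)) @ \oo --> dot x (L *m x).
  rewrite fE; under eq_fun do rewrite fE.
  apply: cvg_big => [|a _]; first exact: add_continuous.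
  apply: cvg_big => [|b _]; first exact: add_continuous.
  apply: cvgM; first exact: cvg_cst.
  by apply: cvgM; [rewrite mxE; apply: cvgE | apply: cvg_cst].
have leL j x : dot x (P j *m x) <= dot x (L *m x).
  have := @nondecreasing_cvgn_le _ (fun j => dot x (P j *m x)) _ (cvgf x) j.
  rewrite (cvg_lim _ (cvgL x)) //; apply.
  by apply/nondecreasing_seqP => i; apply: mP.
exists L; split=> //.
  by apply/matrixP=> a b; rewrite !mxE; congr (limn _); apply/funext => j;
     rewrite -{1}sP mxE.
move=> x e e0; have /cvgrPdist_lt/(_ e e0)[j0 _ hj0] := cvgL x.
exists j0 => j /hj0 /=; rewrite ger0_norm ?subr_ge0 //.
by rewrite ltrBlDl => /ltW.
Qed.

End Limits.

Section KYP.
Variable R : realType.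

Section Forms.
Variables (N m : nat) (A : 'M[R]_N) (B : 'M[R]_(N, m)) (C : 'M[R]_(m, N))
  (D : 'M[R]_m).

Lemma kyp_mx_mul (P : 'M[R]_N) (x : 'cV_N) (u : 'cV_m) :
  kyp_mx A B C D P *m col_mx x u =
  col_mx ((A^T *m P + P *m A) *m x + (P *m B - C^T) *m u)
         ((B^T *m P - C) *m x + (- D - D^T) *m u).
Proof. by rewrite /kyp_mx mul_block_col. Qed.

Lemma kyp_form (P : 'M[R]_N) x u : P^T = P ->
  dot (col_mx x u) (kyp_mx A B C D P *m col_mx x u) =
  2 * (dot x (P *m (A *m x + B *m u)) - dot u (C *m x + D *m u)).
Proof.
move=> sP; rewrite kyp_mx_mul dot_col_mx.
rewrite !(mulmxDl, mulmxDr, mulNmx, dotDr, dotNr) -!mulmxA.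
have -> : dot x (A^T *m (P *m x)) = dot x (P *m (A *m x)).
  by rewrite dot_adj trmxK dotC [RHS]dot_adj sP.
have -> : dot u (B^T *m (P *m x)) = dot x (P *m (B *m u)).
  by rewrite dot_adj trmxK dotC [RHS]dot_adj sP.
have -> : dot x (C^T *m u) = dot u (C *m x) by rewrite dot_adj trmxK dotC.
have -> : dot u (D^T *m u) = dot u (D *m u) by rewrite dot_adj trmxK dotC.
ring.
Qed.

Lemma kyp_mx_sym (P : 'M[R]_N) : P^T = P ->
  (kyp_mx A B C D P)^T = kyp_mx A B C D P.
Proof.
move=> sP; rewrite /kyp_mx tr_block_mx; congr block_mx.
- by rewrite linearD /= !trmx_mul trmxK sP addrC.
- by rewrite linearB /= trmx_mul trmxK sP.
- by rewrite linearB /= trmx_mul trmxK sP.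
- by rewrite linearB linearN /= trmxK addrC.
Qed.

(** The KYP inequality as a dissipation inequality: the stored energy
[x^T P x / 2] grows at most at the rate [u^T y]. *)
Lemma kyp_dissipation (P : 'M[R]_N) :
  psd_kyp_solution A B C D P <->
  psdmx P /\ forall x u,
    dot x (P *m (A *m x + B *m u)) <= dot u (C *m x + D *m u).
Proof.
split=> -[hP h]; split=> //; have [sP _] := (psdmxP P).1 hP.
  move=> x u; have := (lemxP (kyp_mx_sym sP) (trmx0 _ _ _)).1 h (col_mx x u).
  by rewrite mul0mx dot0r kyp_form // pmulr_rle0 // subr_le0.
apply/lemxP; [exact: kyp_mx_sym | exact: trmx0 | move=> z].
rewrite -[z]vsubmxK mul0mx dot0r kyp_form // pmulr_rle0 // subr_le0.
exact: h.
Qed.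

(** A vector on which a semidefinite form vanishes belongs to its kernel. *)
Lemma kyp_lossless (P : 'M[R]_N) x u : psd_kyp_solution A B C D P ->
  dot x (P *m (A *m x + B *m u)) = dot u (C *m x + D *m u) ->
  (A^T *m P + P *m A) *m x + (P *m B - C^T) *m u = 0 /\
  (B^T *m P - C) *m x + (- D - D^T) *m u = 0.
Proof.
move=> [hP h] e; have [sP _] := (psdmxP P).1 hP.
have := @psd_isotropic _ _ _ (col_mx x u) h.
rewrite sub0r mulNmx dotNr kyp_form // e subrr mulr0 oppr0 => /(_ erefl)/eqP.
by rewrite oppr_eq0 kyp_mx_mul col_mx_eq0 => /andP[/eqP-> /eqP->].
Qed.

End Forms.

(** Without feedthrough, the state [0] with any input neither stores nor receives
energy. *)
Lemma kyp_input_output (N m : nat) (A : 'M[R]_N) (B : 'M_(N, m)) C P :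
  psd_kyp_solution A B C 0 P -> P *m B = C^T.
Proof.
move=> h; apply: eq_mulmx_cV => u; apply/eqP; rewrite -subr_eq0 -mulmxBl.
have [|e _] := @kyp_lossless _ _ A B C 0 P 0 u h.
  by rewrite !mulmx0 mul0mx addr0 dot0l dot0r.
by rewrite mulmx0 add0r in e; rewrite e.
Qed.

(** The storage function of an observable system is positive: its kernel is
invariant and contained in the kernel of the output. *)
Lemma kyp_spd (N m : nat) (A : 'M[R]_N) (B : 'M_(N, m)) C D P :
  reachable A^T C^T -> psd_kyp_solution A B C D P -> spdmx P.
Proof.
move=> obs h; apply: psd_spd; first by case: h.
have step (x : 'cV[R]_N) : P *m x = 0 -> P *m (A *m x) = 0 /\ C *m x = 0.
  move=> Px.
  have [|e1 e2] := @kyp_lossless _ _ A B C D P x 0 h.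
    rewrite !mulmx0 addr0 dot0l dot_adj.
    by have [/psdmxP[-> _] _] := h; rewrite Px dot0l.
  move: e1 e2; rewrite !mulmx0 !addr0 mulmxDl mulmxBl -!mulmxA Px !mulmx0.
  by rewrite add0r sub0r => -> /eqP; rewrite oppr_eq0 => /eqP.
move=> x Px.
have all k : P *m (A ^+ k *m x) = 0.
  elim: k => [|k IH]; first by rewrite expr0 mul1mx.
  by rewrite expmxS -mulmxA (step _ IH).1.
apply: trmx_inj; rewrite trmx0; apply: obs => k; apply: trmx_inj.
by rewrite trmx0 !trmx_mul trmx_exp !trmxK (step _ (all k)).2.
Qed.

(** For the storage [x^T x / 2] the power balance of a compressed system is that
of the given system at the points of the subspace. *)
Lemma kyp_compress (N k m : nat) (A : 'M[R]_N) (B : 'M_(N, m)) C D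
    (X : 'M[R]_(N, k)) : X^T *m X = 1%:M ->
  psd_kyp_solution A B C D 1%:M ->
  psd_kyp_solution (X^T *m A *m X) (X^T *m B) (C *m X) D 1%:M.
Proof.
move=> o /kyp_dissipation[_ h]; apply/kyp_dissipation; split.
  by apply/psdmxP; split=> [|x]; rewrite ?trmx1 // mul1mx dot_ge0.
move=> x u; have := h (X *m x) u; rewrite !mul1mx -!mulmxA -mulmxDr.
by rewrite [in X in _ -> X]dot_adj trmxK.
Qed.

Lemma kyp_similar (N N' m : nat) (A : 'M[R]_N) (B : 'M_(N, m)) C D
    (A' : 'M[R]_N') (B' : 'M_(N', m)) C' (T : 'M[R]_(N, N')) P :
  A *m T = T *m A' -> B = T *m B' -> C *m T = C' ->
  psd_kyp_solution A B C D P -> psd_kyp_solution A' B' C' D (T^T *m P *m T).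
Proof.
move=> hA hB hC /kyp_dissipation[hP h]; apply/kyp_dissipation.
split; first exact: psd_congr.
move=> x u.
have e : A *m (T *m x) + B *m u = T *m (A' *m x + B' *m u).
  by rewrite mulmxDr !mulmxA -hA -hB.
by have := h (T *m x) u; rewrite e -hC -!mulmxA [in X in _ -> X]dot_adj trmxK.
Qed.

Lemma psd_sym N (P : 'M[R]_N) : psdmx P -> P^T = P. Proof. by case. Qed.

Lemma minimal_kyp_similar (N N' m : nat) (A : 'M[R]_N) (B : 'M_(N, m)) C D
    (A' : 'M[R]_N') (B' : 'M_(N', m)) C' (T : 'M[R]_(N, N')) (T' : 'M_(N', N)) P :
  T *m T' = 1%:M -> T' *m T = 1%:M ->
  A *m T = T *m A' -> B = T *m B' -> C *m T = C' ->
  minimal_kyp_solution A B C D P ->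
  minimal_kyp_solution A' B' C' D (T^T *m P *m T).
Proof.
move=> TT' T'T hA hB hC [hP hmin]; split; first exact: kyp_similar hP.
move=> P' hP'.
have hA' : A' *m T' = T' *m A.
  by rewrite -[A' *m T']mul1mx -T'T -!mulmxA (mulmxA T) -hA -!mulmxA TT' mulmx1.
have hB' : B' = T' *m B by rewrite hB mulmxA T'T mul1mx.
have hC' : C' *m T' = C by rewrite -hC -mulmxA TT' mulmx1.
have := hmin _ (kyp_similar hA' hB' hC' hP'); rewrite /lemx.
move=> /(psd_congr T); rewrite mulmxBr mulmxBl.
by rewrite -!mulmxA T'T mulmx1 mulmxA -trmx_mul T'T trmx1 mul1mx.
Qed.

(** The dual dissipation inequality at the state [Q^-1 x] and the input [- u] is
the required one at [x] and [u]. *)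
Lemma kyp_dual_inv (N m : nat) (A : 'M[R]_N) (B : 'M_(N, m)) C D Q :
  spdmx Q -> psd_kyp_solution A^T C^T B^T D^T Q ->
  psd_kyp_solution A B C D (invmx Q).
Proof.
move=> hQ /kyp_dissipation[_ h]; apply/kyp_dissipation.
have [sQ _] := hQ; have uQ := spd_unit hQ.
split; first exact/spd_psd/spd_inv.
move=> x u; have := h (invmx Q *m x) (- u).
rewrite dot_adj sQ mulKVmx // !mulmxN !mulmxDr !(dotDr, dotNr, dotNl, opprK).
have -> : dot x (A^T *m (invmx Q *m x)) = dot x (invmx Q *m (A *m x)).
  by rewrite dot_adj trmxK dotC [RHS]dot_adj trmx_inv sQ.
have -> : dot x (C^T *m u) = dot u (C *m x) by rewrite dot_adj trmxK dotC.
have -> : dot u (B^T *m (invmx Q *m x)) = dot x (invmx Q *m (B *m u)).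
  by rewrite dot_adj trmxK dotC [RHS]dot_adj trmx_inv sQ.
have -> : dot u (D^T *m u) = dot u (D *m u) by rewrite dot_adj trmxK dotC.
lra.
Qed.

End KYP.

(** * Existence of the minimal solution *)

Section MinimalSolution.
Variables (R : realType) (N m : nat).
Variables (A : 'M[R]_N) (B : 'M[R]_(N, m)) (C : 'M[R]_(m, N)) (D : 'M[R]_m).
Hypothesis uA : (1%:M - A) \in unitmx.

(** The Cayley transform: the midpoint [cay_x] of the step from [xi] to
[cay_next], which is driven by [u] and has the output [cay_y]. *)
Definition cay_x (xi : 'cV[R]_N) (u : 'cV[R]_m) : 'cV[R]_N :=
  invmx (1%:M - A) *m (xi + B *m u).
Definition cay_next xi u := 2 *: cay_x xi u - xi.
Definition cay_y xi u := C *m cay_x xi u + D *m u.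

Definition cay_gain (P : 'M[R]_N) xi u : R :=
  dot (cay_next xi u) (P *m cay_next xi u) - 4 * dot u (cay_y xi u).

Lemma cay_x_id (x : 'cV[R]_N) u : cay_x (x - (A *m x + B *m u)) u = x.
Proof.
rewrite /cay_x opprD addrA subrK -{1}[x]mul1mx -mulmxBl mulKmx //.
Qed.

Lemma cay_x_eq xi u : A *m cay_x xi u + B *m u = cay_x xi u - xi.
Proof.
have : (1%:M - A) *m cay_x xi u = xi + B *m u by rewrite mulKVmx.
rewrite mulmxBl mul1mx; set x := cay_x xi u => e.
apply/eqP; rewrite eq_sym subr_eq -[X in X == _](subrK (A *m x)) e; apply/eqP.
by rewrite addrC (addrC xi) addrA.
Qed.

(** The Cayley transform turns the continuous-time inequality into a
discrete-time one with the same solutions, since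
[(x + w)^T P (x + w) - (x - w)^T P (x - w) = 4 x^T P w]. *)
Lemma cay_kyp (P : 'M[R]_N) : psd_kyp_solution A B C D P <->
  psdmx P /\ forall xi u, cay_gain P xi u <= dot xi (P *m xi).
Proof.
have key (x w : 'cV[R]_N) : P^T = P ->
    dot (2 *: x - (x - w)) (P *m (2 *: x - (x - w))) -
    dot (x - w) (P *m (x - w)) = 4 * dot x (P *m w).
  move=> sP; have -> : 2 *: x - (x - w) = x + w.
    by rewrite scaler_nat mulr2n opprB addrC addrA subrK addrC.
  rewrite mulmxDr mulmxBr !(dotDl, dotDr, dotNl, dotNr).
  have -> : dot w (P *m x) = dot x (P *m w) by rewrite dotC [RHS]dot_adj sP.
  by ring.
rewrite kyp_dissipation; split=> -[hP h]; split=> //; have sP := psd_sym hP.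
  move=> xi u; have := h (cay_x xi u) u; rewrite cay_x_eq => {}h.
  have := key (cay_x xi u) (cay_x xi u - xi) sP.
  rewrite subKr -/(cay_next xi u) => e; rewrite /cay_gain.
  rewrite -subr_le0 addrAC e -mulrBr pmulr_rle0 // subr_le0.
  exact: h.
move=> x u; set w := A *m x + B *m u.
have := h (x - w) u; rewrite /cay_gain /cay_next /cay_y cay_x_id.
rewrite -subr_le0 addrAC key // -mulrBr pmulr_rle0 // subr_le0 //.
Qed.

Definition cay_F : 'M[R]_N := 2 *: invmx (1%:M - A) - 1%:M.
Definition cay_G : 'M[R]_(N, m) := 2 *: (invmx (1%:M - A) *m B).
Definition cay_H : 'M[R]_(m, N) := C *m invmx (1%:M - A).
Definition cay_W : 'M[R]_m := C *m (invmx (1%:M - A) *m B) + D.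

Lemma cay_nextE xi u : cay_next xi u = cay_F *m xi + cay_G *m u.
Proof.
rewrite /cay_next /cay_F /cay_G /cay_x mulmxDr scalerDr mulmxBl mul1mx.
by rewrite -!scalemxAl mulmxA addrAC.
Qed.

Lemma cay_yE xi u : cay_y xi u = cay_H *m xi + cay_W *m u.
Proof.
by rewrite /cay_y /cay_x /cay_H /cay_W mulmxDr mulmxDr mulmxDl !mulmxA addrA.
Qed.

Definition cay_K (P : 'M[R]_N) (e : R) : 'M[R]_m :=
  e%:M + 2 *: (cay_W + cay_W^T) - cay_G^T *m P *m cay_G.
Definition cay_M (P : 'M[R]_N) : 'M[R]_(N, m) :=
  cay_F^T *m P *m cay_G - 2 *: cay_H^T.

Lemma cay_gainE (P : 'M[R]_N) e xi u : P^T = P ->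
  cay_gain P xi u - e * dot u u = dot xi (cay_F^T *m P *m cay_F *m xi)
    + 2 * dot xi (cay_M P *m u) - dot u (cay_K P e *m u).
Proof.
move=> sP; rewrite /cay_gain cay_nextE cay_yE /cay_M /cay_K.
move: cay_F cay_G cay_H cay_W => F G H W.
rewrite !(mulmxDr, mulmxDl, mulmxBl, mulNmx, dotDl, dotDr, dotNr).
rewrite -!mulmxA -!scalemxAl !dotZr mul_scalar_mx dotZr.
have t p q (X : 'M[R]_(p, q)) x y : dot x (X^T *m y) = dot (X *m x) y.
  by rewrite dot_adj trmxK.
rewrite !t mulmxDl dotDr t (dotC (W *m u)) (dotC (H *m xi)).
have -> : dot (G *m u) (P *m (F *m xi)) =
          dot (F *m xi) (P *m (G *m u)) by rewrite dotC [RHS]dot_adj sP.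
by ring.
Qed.

(** One step of value iteration for the available storage. The supremum over
the inputs is a Schur complement of the quadratic form [cay_gain P]; the
penalty [e |u|^2] makes the block [cay_K P e] to be inverted definite. *)
Definition cay_step (e : R) (P : 'M[R]_N) : 'M[R]_N :=
  cay_F^T *m P *m cay_F + cay_M P *m invmx (cay_K P e) *m (cay_M P)^T.

Definition cay_argmax (e : R) (P : 'M[R]_N) xi : 'cV[R]_m :=
  invmx (cay_K P e) *m (cay_M P)^T *m xi.

Lemma cay_K_spd (P : 'M[R]_N) e : P^T = P -> 0 < e ->
  (forall u, cay_gain P 0 u <= 0) -> spdmx (cay_K P e).
Proof.
move=> sP e0 h; split.
  rewrite /cay_K linearB /= linearD /= tr_scalar_mx !trmx_mul trmxK sP mulmxA.
  by rewrite linearZ /= linearD /= trmxK [cay_W + _]addrC.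
move=> u uN0; have := cay_gainE e 0 u sP.
rewrite mulmx0 dot0r dot0l mulr0 addr0 add0r => E.
have := h u; have : 0 < e * dot u u by rewrite mulr_gt0 // dot_gt0.
lra.
Qed.

Lemma cay_step_sym (P : 'M[R]_N) e : P^T = P -> 0 < e ->
  (forall u, cay_gain P 0 u <= 0) -> (cay_step e P)^T = cay_step e P.
Proof.
move=> sP e0 h; have [sK _] := cay_K_spd sP e0 h.
by rewrite /cay_step linearD /= !trmx_mul !trmxK trmx_inv sP sK !mulmxA.
Qed.

Lemma cay_step_max (P : 'M[R]_N) e xi u : P^T = P -> 0 < e ->
  (forall u, cay_gain P 0 u <= 0) ->
  cay_gain P xi u - e * dot u u <= dot xi (cay_step e P *m xi)
  ?= iff (u == cay_argmax e P xi).
Proof.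
move=> sP e0 h; have hK := cay_K_spd sP e0 h; have uK := spd_unit hK.
set w := cay_argmax e P xi.
have Kw : cay_K P e *m w = (cay_M P)^T *m xi.
  by rewrite /w /cay_argmax -mulmxA mulKVmx.
have E : dot xi (cay_step e P *m xi) - (cay_gain P xi u - e * dot u u) =
         dot (u - w) (cay_K P e *m (u - w)).
  rewrite cay_gainE // /cay_step mulmxDl dotDr -!mulmxA.
  rewrite mulmxBr dotBl !dotBr Kw -/w.
  have -> : invmx (cay_K P e) *m ((cay_M P)^T *m xi) = w.
    by rewrite /w /cay_argmax mulmxA.
  have -> : dot w (cay_K P e *m u) = dot u ((cay_M P)^T *m xi).
    by rewrite dot_adj hK.1 Kw dotC.
  have -> : dot xi (cay_M P *m w) = dot w ((cay_M P)^T *m xi).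
    by rewrite dot_adj dotC.
  have -> : dot xi (cay_M P *m u) = dot u ((cay_M P)^T *m xi).
    by rewrite dot_adj dotC.
  by ring.
split; first by rewrite -subr_ge0 E; have [_] := (psdmxP _).1 (spd_psd hK); apply.
apply/idP/idP => [/eqP e'|/eqP e'].
  apply: contraT; rewrite -subr_eq0 => /(hK.2); rewrite -E e' subrr ltxx //.
by move: E; rewrite e' subrr mulmx0 dot0r => /eqP; rewrite subr_eq0 eq_sym.
Qed.

Lemma cay_gain_mono (P Q : 'M[R]_N) xi u :
  (forall x, dot x (P *m x) <= dot x (Q *m x)) ->
  cay_gain P xi u <= cay_gain Q xi u.
Proof. by move=> h; rewrite /cay_gain lerB. Qed.

(** The least solution is the available storage, the limit of value iteration
from [0]: each iterate stays below every solution, because a solution is a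
supersolution of the (monotone) iteration. *)
Lemma minimal_kyp_exists (Q : 'M[R]_N) : psd_kyp_solution A B C D Q ->
  exists P, minimal_kyp_solution A B C D P.
Proof.
move=> hQ; pose e j : R := j.+1%:R^-1.
have e0 j : 0 < e j by rewrite invr_gt0 ltr0n.
pose P := fix P j := if j is i.+1 then cay_step (e i) (P i) else 0.
pose below X (Y : 'M[R]_N) := forall x, dot x (X *m x) <= dot x (Y *m x).
have gain0 X Y : psd_kyp_solution A B C D Y -> below X Y ->
    forall u, cay_gain X 0 u <= 0.
  move=> /cay_kyp[_ hY] le u; apply: le_trans (cay_gain_mono 0 u le) _.
  by apply: le_trans (hY 0 u) _; rewrite dot0l.
have inv j : psdmx (P j) /\ forall Y, psd_kyp_solution A B C D Y -> below (P j) Y.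
  elim: j => [|j [pj bj]] /=.
    split; first by apply/psdmxP; split=> [|x]; rewrite ?trmx0 // mul0mx dot0r.
    by move=> Y [/psdmxP[_ hY] _] x; rewrite mul0mx dot0r.
  have sP := psd_sym pj; have g0 := gain0 _ _ hQ (bj _ hQ).
  split.
    apply/psdmxP; split=> [|x]; first exact: cay_step_sym.
    apply: le_trans (cay_step_max x 0 sP (e0 j) g0).1.
    rewrite /cay_gain !dot0l !mulr0 !subr0.
    by have [_] := (psdmxP _).1 pj; apply.
  move=> Y hY x; have := (cay_step_max x (cay_argmax (e j) (P j) x) sP (e0 j) g0).2.
  rewrite eqxx => /eqP <-.
  apply: (@le_trans _ _ (cay_gain (P j) x (cay_argmax (e j) (P j) x))).
    by rewrite gerBl mulr_ge0 ?dot_ge0 // ltW.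
  apply: le_trans (cay_gain_mono _ _ (bj Y hY)) _.
  by have /cay_kyp[_] := hY; apply.
have sP j := psd_sym (inv j).1.
have g0 j := gain0 _ _ hQ ((inv j).2 _ hQ).
have mono j : below (P j) (P j.+1).
  elim: j => [|j IH] x.
    by rewrite mul0mx dot0r; have [/psdmxP[_ h] _] := inv 1%N; apply: h.
  have /esym := (cay_step_max x (cay_argmax (e j) (P j) x) (sP j) (e0 j) (g0 j)).2.
  rewrite eqxx => /esym/eqP; set u := cay_argmax _ _ _ => E.
  rewrite [X in X <= _](_ : _ = cay_gain (P j) x u - e j * dot u u); last by rewrite E.
  apply: le_trans (cay_step_max x u (sP j.+1) (e0 j.+1) (g0 j.+1)).1.
  apply: lerB; first exact: cay_gain_mono.
  apply: ler_wpM2r; first exact: dot_ge0.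
  by rewrite lef_pV2 ?posrE ?ltr0n // ler_nat.
have [L [sL leL cvL]] := monotone_sym_limit sP mono (fun j => (inv j).2 Q hQ).
exists L; split.
  apply/cay_kyp; split.
    by apply/psdmxP; split=> // x; have := leL 0%N x; rewrite mul0mx dot0r.
  move=> xi u; apply/ler_addgt0Pr => d d0.
  have d2 : 0 < d / 2 by rewrite divr_gt0.
  have [j0 hj0] := cvL (cay_next xi u) _ d2.
  have [j1 hj1] : exists j1, forall j, (j1 <= j)%N -> e j * dot u u <= d / 2.
    exists (Num.truncn (dot u u / (d / 2))) => j hj.
    rewrite /e ler_pdivrMl ?ltr0n // -ler_pdivrMr //.
    apply: ltW; apply: lt_le_trans (truncnS_gt _) _.
    by rewrite ler_nat ltnS.
  pose j := maxn j0 j1.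
  have b0 := hj0 j (leq_maxl _ _); have b1 := hj1 j (leq_maxr _ _).
  have b2 := le_trans (cay_step_max xi u (sP j) (e0 j) (g0 j)).1 (leL j.+1 xi).
  move: b0 b1 b2; rewrite /cay_gain.
  lra.
move=> Y hY; apply/lemxP => //; first by case: hY => /psd_sym.
move=> x; apply/ler_addgt0Pr => d d0.
have [j0 /(_ j0 (leqnn _)) h] := cvL x d d0.
by apply: le_trans h _; rewrite lerD2r; apply: (inv j0).2.
Qed.

End MinimalSolution.

(** * Reachability, conservative and damped motions *)

Section Reachability.
Variable F : fieldType.

Lemma reachable_mx (N q p : nat) (A : 'M[F]_N) (B : 'M_(N, q)) (X : 'M_(p, N)) :
  reachable A B -> (forall k, X *m A ^+ k *m B = 0) -> X = 0.
Proof.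
move=> h hX; apply/row_matrixP=> i; rewrite row0; apply: h => k.
by rewrite -!row_mul hX row0.
Qed.

Lemma reachable_similar (N N' q : nat) (A : 'M[F]_N) (B : 'M_(N, q))
    (A' : 'M_N') (B' : 'M_(N', q)) (X : 'M_(N', N)) :
  X *m A = A' *m X -> X *m B = B' ->
  (forall v : 'rV_N', v *m X = 0 -> v = 0) ->
  reachable A B -> reachable A' B'.
Proof.
move=> hA hB inj h v hv; apply/inj/h => k.
by rewrite -(mulmxA v) -(intertwine_exp k (esym hA)) -!mulmxA hB mulmxA.
Qed.

(** [S] conjugates the dual system into the given one, up to a sign of the input
that does not matter for reachability. *)
Lemma reachable_dual (N q : nat) (A S : 'M[F]_N) (B : 'M_(N, q)) (C : 'M_(q, N)) :
  S \in unitmx -> S *m A = A^T *m S -> (S *m B = C^T \/ S *m B = - C^T) ->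
  reachable A B -> reachable A^T C^T.
Proof.
move=> uS hA hB h v hv; suff vS : v *m S = 0 by rewrite -(mulmxK uS v) vS mul0mx.
apply: h => k; rewrite -(mulmxA v) -(intertwine_exp k (esym hA)) -!mulmxA.
by case: hB => ->; rewrite ?mulmxN ?mulmxA hv ?oppr0.
Qed.

(** A row [v] that is orthogonal to everything reachable through [A06] evolves,
when extended by [0], under [A00] alone. *)
Lemma reachable_strip (k m : nat) (A00 : 'M[F]_k) (A06 : 'M_(k, m)) A60 A66
    (B6 : 'M_m) :
  reachable (block_mx A00 A06 A60 A66) (col_mx 0 B6) -> reachable A00 A06.
Proof.
move=> h v hv.
suff e j : row_mx v 0 *m block_mx A00 A06 A60 A66 ^+ j = row_mx (v *m A00 ^+ j) 0.
  have /eqP : row_mx v (0 : 'rV_m) = 0.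
    by apply: h => j; rewrite e mul_row_col mulmx0 mul0mx addr0.
  by rewrite row_mx_eq0 => /andP[/eqP].
elim: j => [|j IH]; first by rewrite !expr0 !mulmx1.
rewrite !expmxSr mulmxA IH mul_row_block !mul0mx !addr0 hv.
by rewrite -mulmxA -expmxSr.
Qed.

Lemma block_diag_exp (r p : nat) (J : 'M[F]_r) (A : 'M_p) j :
  (block_mx J 0 0 A) ^+ j = block_mx (J ^+ j) 0 0 (A ^+ j).
Proof.
elim: j => [|j IH]; first by rewrite !expr0 -scalar_mx_block.
by rewrite !expmxS IH mulmx_block !mulmx0 !mul0mx !addr0 add0r.
Qed.

Lemma reachable_split (r p q : nat) (J : 'M[F]_r) (A : 'M_p)
    (B : 'M_(r, q)) (B' : 'M_(p, q)) :
  reachable (block_mx J 0 0 A) (col_mx B B') -> reachable J B /\ reachable A B'.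
Proof.
move=> h; split=> v hv.
  have /eqP : row_mx v (0 : 'rV_p) = 0.
    apply: h => j; rewrite block_diag_exp mul_row_block mul_row_col.
    by rewrite !mul0mx !mulmx0 !addr0 mul0mx addr0.
  by rewrite row_mx_eq0 => /andP[/eqP].
have /eqP : row_mx (0 : 'rV_r) v = 0.
  apply: h => j; rewrite block_diag_exp mul_row_block mul_row_col.
  by rewrite !mul0mx !mulmx0 !add0r mul0mx add0r.
by rewrite row_mx_eq0 => /andP[_ /eqP].
Qed.

End Reachability.

Section Dissipative.
Variable R : realType.

(** [damped A]: energy [x^T x / 2] never increases along [x' = A x], and no
trajectory conserves it. *)
Definition damped (N : nat) (A : 'M[R]_N) : Prop :=
  psdmx (- (A + A^T)) /\ reachable A^T (A + A^T).

Lemma psd_trace0 (N : nat) (M : 'M[R]_N) : psdmx M -> \tr M = 0 -> M = 0.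
Proof.
move=> hM t0; have [_ h] := (psdmxP M).1 hM.
have dE i : dot (delta_mx i 0) (M *m delta_mx i 0) = M i i.
  by rewrite /dot -colE mxE (bigD1 i) //= !mxE !eqxx mul1r big1 ?addr0 // => j ji;
     rewrite !mxE (negbTE ji) mul0r.
have d0 i : M i i = 0.
  have /eqP := t0; rewrite /mxtrace psumr_eq0; last by move=> j _; rewrite -dE.
  by move=> /allP/(_ i (mem_index_enum _)) /eqP.
apply/matrixP=> i j; have := psd_isotropic hM (etrans (dE j) (d0 j)).
by rewrite -colE => /matrixP/(_ i 0); rewrite !mxE.
Qed.

Lemma mxtrace_skew_sym (N : nat) (K Y : 'M[R]_N) :
  K^T = - K -> Y^T = Y -> \tr (K *m Y) = 0.
Proof.
move=> sK sY; have := mxtrace_tr (K *m Y).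
by rewrite trmx_mul sK sY mulmxN linearN /= mxtrace_mulC => h; lra.
Qed.

(** Sylvester equation: a damped and a conservative motion have no mode in
common. The trace gives an energy balance that avoids any spectral argument. *)
Lemma damped_skew_sylvester (p r : nat) (A : 'M[R]_p) (K : 'M[R]_r)
    (X : 'M[R]_(r, p)) : damped A -> K^T = - K -> X *m A = K *m X -> X = 0.
Proof.
move=> [dA oA] sK h; set H := A + A^T.
have XH : X *m H = 0.
  have M0 : X *m - H *m X^T = 0.
    apply: psd_trace0; first by rewrite -{1}[X]trmxK; exact: psd_congr.
    rewrite mulmxN mulNmx linearN /= /H mulmxDr mulmxDl h linearD /=.
    rewrite -(mulmxA X A^T) -trmx_mul h trmx_mul sK !mulmxN -mulmxA.
    by rewrite linearN /= (mulmxA X) (mxtrace_mulC (X *m X^T)) subrr oppr0.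
  apply: trmx_inj; rewrite trmx0 trmx_mul; apply: eq_mulmx_cV => x; rewrite mul0mx.
  have sH : H^T = H by rewrite /H linearD /= trmxK addrC.
  have e : dot (X^T *m x) (- H *m (X^T *m x)) = 0.
    by rewrite -[RHS](dot0r x) -(mul0mx _ x) -M0 -!mulmxA [RHS]dot_adj.
  by have /eqP := psd_isotropic dA e; rewrite mulNmx oppr_eq0 sH -mulmxA => /eqP.
apply: (reachable_mx oA) => k.
have hT : X *m A^T = - K *m X.
  by apply/eqP; rewrite mulNmx -h -subr_eq0 opprK -mulmxDr addrC -/H XH.
by rewrite -(intertwine_exp k (esym hT)) -mulmxA XH mulmx0.
Qed.

Lemma damped_inj (p : nat) (A : 'M[R]_p) (x : 'cV_p) :
  damped A -> A *m x = 0 -> x = 0.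
Proof.
move=> [dA oA] h; apply: trmx_inj; rewrite trmx0; apply: oA => k.
have : dot x ((- (A + A^T)) *m x) = 0.
  rewrite mulNmx mulmxDl h add0r dotNr dot_adj trmxK h dot0l oppr0 //.
move=> /(psd_isotropic dA) /eqP; rewrite mulNmx oppr_eq0 mulmxDl h add0r => /eqP hT.
case: k => [|k]; last by rewrite exprS -mulmxE !mulmxA -trmx_mul h trmx0 !mul0mx.
by rewrite expr0 mulmx1 mulmxDr -!trmx_mul h trmx0 addr0 -[x^T *m A]trmxK
   trmx_mul trmxK hT trmx0.
Qed.

Lemma eigen_rows (N : nat) (A : 'M[R]_N) (z : R[i]) :
  eigenvalue (toCmx A) z -> exists a b : 'rV[R]_N,
  [/\ 0 < dot a^T a^T + dot b^T b^T,
    a *m A = complex.Re z *: a - complex.Im z *: b,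
    b *m A = complex.Im z *: a + complex.Re z *: b &
    dot a^T (A *m a^T) + dot b^T (A *m b^T) =
    complex.Re z * (dot a^T a^T + dot b^T b^T)].
Proof.
move=> /eigenvalue_realP[a [b [nz ha hb]]]; exists a, b; split=> //.
  have na := dot_ge0 a^T; have nb := dot_ge0 b^T.
  case/orP: nz => nz; first by rewrite ltr_pwDl // dot_gt0 // trmx_eq0.
  by rewrite ltr_wpDl // dot_gt0 // trmx_eq0.
rewrite !dot_adj -!trmx_mul ha hb linearB linearD /= !linearZ /=.
rewrite !(dotDl, dotNl, dotZl) (dotC b^T a^T); ring.
Qed.

Lemma skew_form (N : nat) (J : 'M[R]_N) x : J^T = - J -> dot x (J *m x) = 0.
Proof.
by move=> sJ; have := dot_adj J x x; rewrite sJ mulNmx dotNl dotC => h; lra.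
Qed.

Lemma skew_eigenvalue (N : nat) (J : 'M[R]_N) z : J^T = - J ->
  eigenvalue (toCmx J) z -> complex.Re z = 0.
Proof.
move=> sJ /eigen_rows[a [b [pos _ _]]]; rewrite !skew_form // addr0.
by move=> /esym/eqP; rewrite mulf_eq0 (gt_eqF pos) orbF => /eqP.
Qed.

(** The energy balance of an eigenvector gives [Re z <= 0]. If [Re z = 0], its
real and imaginary parts span an invariant plane on which the motion is
conservative, which the Sylvester equation excludes. *)
Lemma damped_stable (N : nat) (A : 'M[R]_N) : damped A -> asymp_stable A.
Proof.
move=> hA z /eigen_rows[a [b [pos ha hb E]]].
have nonpos x : dot x (A *m x) <= 0.
  have [_ /(_ x)] := (psdmxP _).1 hA.1.
  rewrite mulNmx mulmxDl dotNr dotDr (dot_adj A^T) trmxK dotC (dotC (A *m x)).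
  by lra.
have rle : complex.Re z <= 0.
  rewrite leNgt; apply/negP=> rpos.
  have := nonpos a^T; have := nonpos b^T.
  have : 0 < complex.Re z * (dot a^T a^T + dot b^T b^T) by rewrite mulr_gt0.
  by lra.
rewrite lt_def rle andbT; apply/eqP => /esym r0.
(* generator of the rotation of that plane *)
pose K : 'M[R]_(1 + 1) := block_mx 0 (- (complex.Im z)%:M) (complex.Im z)%:M 0.
have : col_mx a b = 0.
  apply: (@damped_skew_sylvester _ _ A K) => //.
    by rewrite /K tr_block_mx opp_block_mx !trmx0 linearN /= !tr_scalar_mx !oppr0 opprK.
  rewrite mul_col_mx ha hb /K mul_block_col !mul0mx r0 !scale0r !add0r !addr0.
  by rewrite mulNmx !mul_scalar_mx.
move=> /eqP; rewrite col_mx_eq0 => /andP[/eqP a0 /eqP b0].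
by move: pos; rewrite a0 b0 trmx0 dot0l addr0 ltxx.
Qed.

(** A dissipative motion is the orthogonal direct sum of a conservative and a
damped one. The conservative part is the orthogonal complement of the Krylov
space of [A^T] generated by the dissipation [A + A^T]. *)
Lemma dissipative_split (k : nat) (A : 'M[R]_k) : psdmx (- (A + A^T)) ->
  exists r p (U : 'M[R]_(k, r)) (V : 'M[R]_(k, p)) (J : 'M[R]_r) (Az : 'M[R]_p),
  [/\ [/\ U^T *m U = 1%:M, V^T *m V = 1%:M, U^T *m V = 0
        & U *m U^T + V *m V^T = 1%:M],
      A *m U = U *m J, A *m V = V *m Az, J^T = - J & damped Az].
Proof.
move=> dA; set H := A + A^T.
have [r [p [U [V [o hU hV _ hr]]]]] := krylov_split A^T H.
exists r, p, U, V, (U^T *m A *m U), (V^T *m A *m V).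
have [oU oV oUV id1] := o.
have oVU : V^T *m U = 0 by apply: trmx_inj; rewrite trmx_mul trmxK oUV trmx0.
have UH : U^T *m H = 0 by have := hU 0; rewrite expr0 mulmx1.
have VA : V^T *m A = (V^T *m A *m V) *m V^T.
  by apply: trmx_inj; rewrite !trmx_mul !trmxK {1}hV -!mulmxA.
have UAV : U^T *m A *m V = 0.
  have : U^T *m A = - (U^T *m A^T).
    by apply/eqP; rewrite -subr_eq0 opprK -mulmxDr UH.
  by move=> ->; rewrite mulNmx -mulmxA hV (mulmxA U^T V) oUV mul0mx oppr0.
have hAU : A *m U = U *m (U^T *m A *m U).
  rewrite -{1}[A *m U]mul1mx -id1 mulmxDl -!mulmxA [V^T *m _]mulmxA VA.
  by rewrite -!mulmxA oVU !mulmx0 addr0.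
have hAV : A *m V = V *m (V^T *m A *m V).
  rewrite -{1}[A *m V]mul1mx -id1 mulmxDl -!mulmxA.
  by rewrite [U^T *m _]mulmxA UAV mulmx0 add0r.
have VH : V^T *m H = (V^T *m A *m V + (V^T *m A *m V)^T) *m V^T.
  rewrite mulmxDr mulmxDl -VA; congr (_ + _).
  by rewrite -trmx_mul hAV trmx_mul.
split=> //.
  apply/eqP; rewrite -subr_eq0 opprK !trmx_mul trmxK mulmxA -mulmxDl -mulmxDr.
  by rewrite addrC UH mul0mx.
split.
  have := psd_congr V dA; rewrite mulmxN mulNmx mulmxDr mulmxDl.
  by rewrite !trmx_mul trmxK !mulmxA.
move=> v hv; have : v *m V^T *m V = 0.
  apply: hr => j; rewrite -(mulmxA v).
  have -> : V^T *m A^T ^+ j = (V^T *m A *m V)^T ^+ j *m V^T.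
    by apply/esym/intertwine_exp; rewrite -!trmx_mul hAV.
  by rewrite -!mulmxA VH !mulmxA hv mul0mx.
by rewrite -mulmxA oV mulmx1.
Qed.

End Dissipative.

(** * Storage, transfer function and zeros of a partitioned system *)

Section Structure.
Variable R : realType.

Lemma psd_block_diag (p q : nat) (P : 'M[R]_p) (Q : 'M_q) :
  psdmx (block_mx P 0 0 Q) <-> psdmx P /\ psdmx Q.
Proof.
rewrite !psdmxP tr_block_mx !trmx0; split.
  move=> [/eq_block_mx[sP _ _ sQ] h]; split; split=> // x.
    have := h (col_mx x 0).
    by rewrite mul_block_col !(mulmx0, mul0mx, addr0) dot_col_mx dot0r addr0.
  have := h (col_mx 0 x).
  by rewrite mul_block_col !(mulmx0, mul0mx, add0r) dot_col_mx dot0r add0r.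
move=> [[-> hP] [-> hQ]]; split=> // x.
rewrite -[x]vsubmxK mul_block_col !mul0mx addr0 add0r dot_col_mx.
by rewrite addr_ge0.
Qed.

Lemma psdmx1 (p : nat) : psdmx (1%:M : 'M[R]_p).
Proof. by apply/psdmxP; split=> [|x]; rewrite ?trmx1 // mul1mx dot_ge0. Qed.

(** The equality [P B = C^T] fixes the energy stored in the block driven by the
input. What remains is the KYP inequality of the inverse system with its
polynomial part removed. *)
Lemma kyp_strip (k m : nat) (A00 : 'M[R]_k) (A06 : 'M_(k, m)) A60 A66
    (B6 : 'M_m) P : B6 \in unitmx ->
  psd_kyp_solution (block_mx A00 A06 A60 A66) (col_mx 0 B6) (col_mx 0 B6)^T 0 P
  <-> exists2 P0, P = block_mx P0 0 0 1%:M
    & psd_kyp_solution A00 A06 (- A60) (- A66) P0.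
Proof.
move=> uB.
have E (P0 : 'M[R]_k) x0 x6 u :
    dot (col_mx x0 x6) (block_mx P0 0 0 1%:M *m
      (block_mx A00 A06 A60 A66 *m col_mx x0 x6 + col_mx 0 B6 *m u)) -
    dot u ((col_mx (0 : 'M_(k, m)) B6)^T *m col_mx x0 x6 + 0 *m u) =
    dot x0 (P0 *m (A00 *m x0 + A06 *m x6)) - dot x6 (- A60 *m x0 + - A66 *m x6).
  rewrite tr_col_mx trmx0 mul_row_col (mul_col_mx _ B6) !mul_block_col.
  rewrite add_col_mx mul_block_col dot_col_mx !mul0mx !add0r !addr0 mul1mx.
  rewrite (dot_adj B6^T) trmxK !mulNmx !(dotDr, dotNr) (dotC (B6 *m u)).
  by ring.
split.
  move=> h; have hP := h.1; have sP := psd_sym hP.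
  have := kyp_input_output h; rewrite trmxK => e.
  have PE : P = block_mx (ulsubmx P) 0 0 1%:M.
    have sub : dlsubmx P = (ursubmx P)^T by rewrite trmx_ursub sP.
    move: e; rewrite -{1}[P]submxK mul_block_col !mulmx0 !add0r => /eq_col_mx[e1 e2].
    have q0 : ursubmx P = 0 by rewrite -(mulmxK uB (ursubmx P)) e1 mul0mx.
    rewrite -[LHS]submxK sub q0 trmx0; congr block_mx.
    by rewrite -(mulmxK uB (drsubmx P)) e2 mulmxV.
  exists (ulsubmx P) => //; move: h; rewrite {1}PE; set P0 := ulsubmx P.
  move=> /kyp_dissipation[/psd_block_diag[hP0 _] h]; apply/kyp_dissipation.
  split=> // x u; have := h (col_mx x u) 0.
  by rewrite -subr_le0 E subr_le0.
move=> [P0 -> /kyp_dissipation[hP0 h]]; apply/kyp_dissipation; split.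
  by apply/psd_block_diag; split=> //; exact: psdmx1.
move=> x u; rewrite -[x]vsubmxK -subr_le0 E subr_le0; exact: h.
Qed.

(** Along the conservative part the rate [P11 J + (P11 J)^T] of the stored energy
is nonpositive and, as [J] is skew, has trace [0]. So it vanishes: [P11] commutes
with [J] and fixes [Bj], which determines it by reachability, and the cross term
solves a Sylvester equation. *)
Lemma kyp_split (r p m : nat) (J : 'M[R]_r) (A : 'M_p) (Bj : 'M_(r, m))
    (B : 'M_(p, m)) (C : 'M_(m, p)) D P :
  J^T = - J -> damped A -> reachable J Bj ->
  psd_kyp_solution (block_mx J 0 0 A) (col_mx Bj B) (row_mx Bj^T C) D P
  <-> exists2 Pz, P = block_mx 1%:M 0 0 Pz & psd_kyp_solution A B C D Pz.
Proof.
move=> sJ dA rJ.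
have E (Pz : 'M[R]_p) xj xz u :
    dot (col_mx xj xz) (block_mx 1%:M 0 0 Pz *m
      (block_mx J 0 0 A *m col_mx xj xz + col_mx Bj B *m u)) -
    dot u (row_mx Bj^T C *m col_mx xj xz + D *m u) =
    dot xz (Pz *m (A *m xz + B *m u)) - dot u (C *m xz + D *m u).
  rewrite mul_row_col (mul_col_mx Bj) !mul_block_col.
  rewrite add_col_mx mul_block_col dot_col_mx !mul0mx !add0r !addr0 mul1mx.
  rewrite (dotDr xj) skew_form // !dotDr (dot_adj Bj^T) trmxK (dotC (Bj *m u)).
  by ring.
split; last first.
  move=> [Pz -> /kyp_dissipation[hPz h]]; apply/kyp_dissipation; split.
    by apply/psd_block_diag; split=> //; exact: psdmx1.
  by move=> x u; rewrite -[x]vsubmxK -subr_le0 E subr_le0; exact: h.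
move=> h; have [hP dis] := (kyp_dissipation _ _ _ _ _).1 h; have sP := psd_sym hP.
set P11 := ulsubmx P; set P12 := ursubmx P; set P22 := drsubmx P.
have PE : P = block_mx P11 P12 P12^T P22.
  by rewrite -[LHS]submxK -[dlsubmx P]trmxK trmx_dlsub sP.
have sP11 : P11^T = P11 by rewrite /P11 trmx_ulsub sP.
have Ax x : block_mx J 0 0 A *m col_mx x 0 = col_mx (J *m x) 0.
  by rewrite mul_block_col !mulmx0 mul0mx !addr0.
have M0 : - (P11 *m J + (P11 *m J)^T) = 0.
  apply: psd_trace0; last first.
    rewrite linearN linearD /= mxtrace_tr mxtrace_mulC.
    by rewrite mxtrace_skew_sym // addr0 oppr0.
  apply/psdmxP; split=> [|x]; first by rewrite linearN linearD /= trmxK addrC.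
  have := dis (col_mx x 0) 0.
  rewrite !mulmx0 !addr0 dot0l Ax PE mul_block_col !mulmx0 !addr0 dot_col_mx dot0l.
  rewrite addr0 mulmxA => hx.
  rewrite mulNmx dotNr mulmxDl dotDr (dot_adj _^T) trmxK (dotC _ x).
  by lra.
have dx x : dot x (P11 *m J *m x) = 0.
  have : dot x (- (P11 *m J + (P11 *m J)^T) *m x) = 0 by rewrite M0 mul0mx dot0r.
  by rewrite mulNmx dotNr mulmxDl dotDr (dot_adj _^T) trmxK (dotC _ x); lra.
have [eqA eqC] : [/\ P11 *m J = J *m P11 & A^T *m P12^T + P12^T *m J = 0] /\
    Bj^T *m P11 + B^T *m P12^T = Bj^T.
  have col (x : 'cV_r) : [/\ (J^T *m P11 + P11 *m J) *m x = 0,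
      (A^T *m P12^T + P12^T *m J) *m x = 0 &
      (Bj^T *m P11 + B^T *m P12^T) *m x = Bj^T *m x].
    have [|e1 e2] := @kyp_lossless _ _ _ _ _ _ _ P (col_mx x 0) 0 h.
      rewrite !mulmx0 !addr0 dot0l Ax PE mul_block_col !mulmx0 !addr0.
      by rewrite dot_col_mx dot0l addr0 mulmxA dx.
    move: e1 e2; rewrite !mulmx0 !addr0 PE mulmxDl mulmxBl -!mulmxA Ax.
    rewrite mul_block_col !mulmx0 !addr0 tr_block_mx !trmx0 tr_col_mx !mul_block_col.
    rewrite mul_row_col !mulmx0 !addr0 !mul0mx !addr0 !add0r add_col_mx.
    rewrite mul_row_col mulmx0 addr0.
    move/eqP; rewrite col_mx_eq0 => /andP[/eqP e1 /eqP e2] /eqP.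
    by rewrite subr_eq0 => /eqP e3; rewrite !mulmxDl -!mulmxA; split.
  split; last by apply: eq_mulmx_cV => x; have [_ _] := col x.
  split; last by apply: eq_mulmx_cV => x; rewrite mul0mx; have [] := col x.
  apply/eqP; rewrite -subr_eq0; apply/eqP; apply: eq_mulmx_cV => x; rewrite mul0mx.
  by have [<- _ _] := col x; rewrite sJ mulNmx addrC.
have P120 : P12 = 0.
  apply: (damped_skew_sylvester dA sJ); apply: trmx_inj.
  apply/eqP; rewrite !trmx_mul sJ mulmxN -subr_eq0 opprK; apply/eqP; exact: eqA.2.
have P111 : P11 = 1%:M.
  apply/eqP; rewrite -subr_eq0; apply/eqP; apply: (reachable_mx rJ) => k.
  have c : (P11 - 1%:M) *m J = J *m (P11 - 1%:M).
    by rewrite mulmxBl mulmxBr eqA.1 mulmx1 mul1mx.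
  rewrite -(intertwine_exp k (esym c)) -mulmxA.
  have -> : (P11 - 1%:M) *m Bj = 0.
    apply: trmx_inj; rewrite trmx_mul linearB /= trmx1 sP11 trmx0 mulmxBr mulmx1.
    rewrite -[X in X - _]addr0 -[X in _ + X - _](mulmx0 _ B^T) -{1}trmx0 -P120.
    by rewrite eqC subrr.
  by rewrite mulmx0.
move: PE; rewrite P111 P120 trmx0 => PE; exists P22 => //.
move: hP dis; rewrite PE => /psd_block_diag[_ hP22] dis; apply/kyp_dissipation.
split=> // x u; have := dis (col_mx 0 x) u.
by rewrite -subr_le0 E subr_le0.
Qed.

End Structure.

Section Transfer.
Variable R : realType.
Local Notation K := {fraction {poly R}}.

Lemma toFmxE (p q : nat) (M : 'M[R]_(p, q)) :
  toFmx M = map_mx (@tofrac _) (map_mx polyC M).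
Proof. by apply/matrixP=> i j; rewrite !mxE. Qed.

Lemma toFmxM (p q r : nat) (M : 'M[R]_(p, q)) (M' : 'M_(q, r)) :
  toFmx (M *m M') = toFmx M *m toFmx M'.
Proof. by rewrite !toFmxE !map_mxM. Qed.

Lemma char_frac_unit (N : nat) (A : 'M[R]_N) :
  (tofrac 'X)%:M - toFmx A \in unitmx.
Proof.
have -> : (tofrac 'X)%:M - toFmx A = map_mx (@tofrac _) (char_poly_mx A).
  apply/matrixP=> i j; rewrite !mxE rmorphB /=; congr (_ - _).
  by rewrite rmorphMn.
rewrite unitmxE det_map_mx unitfE tofrac_eq0 -size_poly_eq0.
by rewrite -/(char_poly A) size_char_poly.
Qed.

(** [X] intertwines the resolvents too. Restriction to an invariant subspace that
contains the reachable states, passage to the quotient by an unobservable one,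
and changes of coordinates are all instances. *)
Lemma transfer_intertwine (N N' m p : nat) (A : 'M[R]_N) (B : 'M_(N, m))
    (C : 'M_(p, N)) D (A' : 'M_N') (B' : 'M_(N', m)) (C' : 'M_(p, N'))
    (X : 'M_(N, N')) :
  A *m X = X *m A' -> B = X *m B' -> C *m X = C' ->
  transfer A B C D = transfer A' B' C' D.
Proof.
move=> hA hB hC; rewrite /transfer; congr (_ + _).
rewrite hB -hC !toFmxM !mulmxA; congr (_ *m _); rewrite -!mulmxA; congr (_ *m _).
set M := _ - toFmx A; set M' := _ - toFmx A'.
have uM : M \in unitmx by apply: char_frac_unit.
have uM' : M' \in unitmx by apply: char_frac_unit.
have e : M *m toFmx X = toFmx X *m M'.
  by rewrite mulmxBl mulmxBr -!toFmxM hA mul_scalar_mx mul_mx_scalar.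
clearbody M M'.
have h : invmx M *m toFmx X *m M' = toFmx X.
  by rewrite -(mulmxA (invmx M)) -e (mulKmx uM).
by move: (mulmxK uM' (invmx M *m toFmx X)); rewrite h => ->.
Qed.

End Transfer.

Section Zeros.

(** The invertible blocks [B6] and [C6] eliminate the last state and the input
from the pencil, which leaves the generator of the zero dynamics. *)
Lemma pencil_strip_unit (K : fieldType) (k m : nat) (s : K) (A00 : 'M[K]_k)
    (A06 : 'M_(k, m)) A60 A66 (B6 C6 : 'M_m) :
  B6 \in unitmx -> C6 \in unitmx ->
  (\rank (pencil s (block_mx A00 A06 A60 A66) (col_mx 0 B6) (row_mx 0 C6) 0)
    == k + m + m)%N = (s%:M - A00 \in unitmx).
Proof.
move=> uB uC; rewrite -/(row_free _) /pencil scalar_mx_block opp_block_mx.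
rewrite add_block_mx !oppr0 !add0r.
apply/idP/idP => [fr|uA].
  rewrite -row_free_unit -kermx_eq0; apply/eqP/row_matrixP=> i; rewrite row0.
  set v := row i _; have hv : v *m (s%:M - A00) = 0.
    by rewrite /v -row_mul mulmx_ker row0.
  pose w := row_mx (row_mx v (0 : 'rV_m)) (- (v *m A06 *m invmx C6)).
  have : w = 0.
    apply: (row_free_inj fr); rewrite mul0mx /w mul_row_block mul_row_block.
    rewrite mul_row_col mul_mx_row !mulmx0 !mul0mx !addr0 add_row_mx.
    rewrite mulNmx mulmxKV // subrr addr0.
    by rewrite [- _ + _]addrC -opprB mulmxN hv oppr0 !row_mx0.
  by move=> /eqP; rewrite /w !row_mx_eq0 => /andP[/andP[/eqP]].
rewrite -kermx_eq0; apply/eqP/row_matrixP=> i; rewrite row0.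
set M := block_mx _ _ _ _; set w := row i _; have : w *m M = 0.
  by rewrite /w -row_mul mulmx_ker row0.
rewrite -[w]hsubmxK -[lsubmx w]hsubmxK /M.
set v := lsubmx (lsubmx w); set v6 := rsubmx (lsubmx w); set y := rsubmx w.
rewrite !mul_row_block mul_row_col mul_mx_row !mulmx0 add_row_mx !addr0 add0r.
move/eqP; rewrite !row_mx_eq0 => /andP[/andP[/eqP e1 /eqP e2] /eqP e3].
have v60 : v6 = 0 by rewrite -(mulmxK uB v6) e3 mul0mx.
rewrite v60 !mul0mx !addr0 in e1 e2.
have v0 : v = 0.
  by rewrite -(mulmxK uA v) -opprB [A00 - _]addrC mulmxN e1 oppr0 mul0mx.
by rewrite v0 mul0mx add0r in e2; rewrite v0 v60 -(mulmxK uC y) e2 mul0mx !row_mx0.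
Qed.

Lemma pencil_similar (K : fieldType) (N N' m p : nat) (s : K) (A : 'M[K]_N)
    (B : 'M_(N, m)) (C : 'M_(p, N)) D (A' : 'M_N') (B' : 'M_(N', m)) C'
    (T : 'M[K]_(N, N')) (T' : 'M_(N', N)) :
  T *m T' = 1%:M -> T' *m T = 1%:M -> A *m T = T *m A' -> B = T *m B' ->
  C *m T = C' -> \rank (pencil s A B C D) = \rank (pencil s A' B' C' D).
Proof.
move=> TT' T'T hA hB hC.
have e : pencil s A B C D *m block_mx T 0 0 1%:M =
         block_mx T 0 0 1%:M *m pencil s A' B' C' D.
  rewrite /pencil !mulmx_block !mulmx0 !mul0mx !addr0 !add0r !mulmx1 !mul1mx hC -hB.
  by congr block_mx; rewrite mulmxDl mulmxDr mulNmx mulmxN hA mul_scalar_mx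
    mul_mx_scalar.
have i1 : block_mx T 0 0 (1%:M : 'M_m) *m block_mx T' 0 0 1%:M = 1%:M.
  by rewrite mulmx_block !mulmx0 !mul0mx !addr0 !add0r mulmx1 TT' -scalar_mx_block.
have i2 : block_mx T' 0 0 (1%:M : 'M_p) *m block_mx T 0 0 1%:M = 1%:M.
  by rewrite mulmx_block !mulmx0 !mul0mx !addr0 !add0r mulmx1 T'T -scalar_mx_block.
apply/eqP; rewrite eqn_leq; apply/andP; split.
  rewrite -[pencil s A B C D]mulmx1 -i1 mulmxA e.
  by rewrite (leq_trans (mxrankM_maxl _ _)) // mxrankM_maxr.
rewrite -[pencil s A' B' C' D]mul1mx -i2 -mulmxA -e.
by rewrite (leq_trans (mxrankM_maxr _ _)) // mxrankM_maxl.
Qed.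

End Zeros.

(** * Reduction to a minimal realization *)

Section Reduction.
Variable R : realType.

Lemma row_mx_res1 (N p q : nat) (U : 'M[R]_(N, p)) (V : 'M[R]_(N, q)) :
  U^T *m U = 1%:M -> V^T *m V = 1%:M -> U^T *m V = 0 ->
  (row_mx U V)^T *m row_mx U V = 1%:M.
Proof.
move=> oU oV oUV; rewrite tr_row_mx mul_col_row oU oV oUV.
by rewrite -[V^T *m U]trmxK trmx_mul trmxK oUV trmx0 -scalar_mx_block.
Qed.

Lemma bijective_dim (p q : nat) (M : 'M[R]_(p, q)) (L : 'M_(q, p)) :
  M *m L = 1%:M -> (forall x : 'cV_q, M *m x = 0 -> x = 0) -> p = q.
Proof.
move=> ML /col_inj_row_free/eqP; rewrite mxrank_tr => rM.
apply/eqP; rewrite eqn_leq -{2}rM rank_leq_row andbT.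
by rewrite -{1}(mxrank1 R p) -ML (leq_trans (mxrankM_maxl _ _)) // rank_leq_col.
Qed.

(** A passive symmetric system with collocated input and output, whose transfer
function vanishes at [0]: [Z] is the equilibrium produced by a constant input,
and it gives no output. The form [S] is a signature for the original system,
but only a symmetric matrix after restriction to a subspace. *)
Definition collocated (N m : nat) (A : 'M[R]_N) (B : 'M_(N, m)) (S : 'M_N)
    (Z : 'M_(N, m)) : Prop :=
  [/\ psd_kyp_solution A B B^T 0 1%:M, S^T = S, S *m A = A^T *m S, S *m B = B
    & A *m Z = B /\ B^T *m Z = 0].

(** The Krylov space of [A] and [B] contains [Z] as well: [A] is invertible, so
that the preimage of an invariant subspace is that subspace. *)
Lemma collocated_reach (N m : nat) (A : 'M[R]_N) (B : 'M_(N, m)) S Z :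
  A \in unitmx -> collocated A B S Z ->
  exists r (A' : 'M[R]_r) (B' : 'M_(r, m)) S' Z',
    [/\ collocated A' B' S' Z', reachable A' B', exists X, B = X *m B' &
        transfer A B B^T 0 = transfer A' B' B'^T 0].
Proof.
move=> uA [kyp sS SA SB [AZ BZ]].
have [k [r [U0 [U [[o0 oU oU0 id1] hU0 hA hB hr]]]]] := krylov_split A B.
set A' := U^T *m A *m U in hA; set B' := U^T *m B in hB.
have BU : B'^T = B^T *m U by rewrite /B' trmx_mul trmxK.
have uA' : A' \in unitmx.
  apply: unitmx_inj => x hx.
  have : A *m (U *m x) = 0 by rewrite mulmxA hA -mulmxA hx mulmx0.
  move=> /(congr1 (mulmx (invmx A))); rewrite mulKmx // mulmx0.
  by move=> /(congr1 (mulmx U^T)); rewrite mulmx0 mulmxA oU mul1mx.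
have UZ : U *m (invmx A' *m B') = Z.
  by rewrite -[LHS](mulKmx uA) (mulmxA A U) hA -mulmxA mulKVmx // -hB -AZ mulKmx.
exists r, A', B', (U^T *m S *m U), (invmx A' *m B'); split.
- split.
  + by rewrite BU; apply: kyp_compress.
  + by rewrite !trmx_mul trmxK sS mulmxA.
  + rewrite -[LHS]mulmxA -hA !mulmxA.
    have -> : A'^T *m U^T = U^T *m A^T by rewrite -!trmx_mul hA.
    by rewrite -(mulmxA U^T) SA mulmxA.
  + by rewrite -mulmxA -hB -mulmxA SB.
  + by rewrite mulKVmx // BU -mulmxA UZ.
- move=> v hv; have : v *m U^T *m U = 0.
    apply: hr => j; rewrite hB -!mulmxA (mulmxA (A ^+ j)) (intertwine_exp j hA).
    by rewrite -mulmxA (mulmxA U^T U) oU mul1mx mulmxA.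
  by rewrite -mulmxA oU mulmx1.
- by exists U.
- by apply: (@transfer_intertwine _ _ _ _ _ _ _ _ _ _ _ _ U).
Qed.

(** The unobservable states are the radical of the form. Its orthogonal complement
is the range of [S], which contains the range of [B] because [S B = B] and is
invariant under [A^T] because [A^T S = S A]. *)
Lemma collocated_nondegenerate (N m : nat) (A : 'M[R]_N) (B : 'M_(N, m)) S Z :
  collocated A B S Z -> reachable A B ->
  exists r (A' : 'M[R]_r) (B' : 'M_(r, m)) S' Z',
    [/\ collocated A' B' S' Z', reachable A' B', S' \in unitmx,
        exists X, B = X *m B' & transfer A B B^T 0 = transfer A' B' B'^T 0].
Proof.
move=> [kyp sS SA SB [AZ BZ]] rAB.
have [k [r [U0 [Y [[o0 oY oY0 id1] _ hU0 [L hY]]]]]] := orth_split S.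
have YS p (X : 'M_(N, p)) : Y *m (Y^T *m (S *m X)) = S *m X.
  by rewrite -[RHS]mul1mx -id1 mulmxDl -!mulmxA (mulmxA U0^T) hU0 mul0mx mulmx0 add0r.
have YYS : Y *m (Y^T *m S) = S by have := YS _ 1%:M; rewrite !mulmx1.
have YB : Y *m (Y^T *m B) = B by rewrite -SB YS.
have SYY : S *m Y *m Y^T = S.
  by apply: trmx_inj; rewrite !trmx_mul trmxK sS YYS.
set A' := Y^T *m A *m Y; set B' := Y^T *m B.
have BY : B'^T = B^T *m Y by rewrite /B' trmx_mul trmxK.
have hA : A^T *m Y = Y *m A'^T.
  have e : A^T *m Y = S *m (A *m L) by rewrite {1}hY !mulmxA SA.
  by rewrite /A' !trmx_mul trmxK e YS.
have hA' : Y^T *m A = A' *m Y^T.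
  by apply: trmx_inj; rewrite trmx_mul trmxK hA [RHS]trmx_mul trmxK.
exists r, A', B', (Y^T *m S *m Y), (Y^T *m Z); split.
- split.
  + by rewrite BY; apply: kyp_compress.
  + by rewrite !trmx_mul trmxK sS mulmxA.
  + have e1 : Y^T *m S *m Y *m Y^T = Y^T *m S.
      by rewrite -!mulmxA (mulmxA S) SYY.
    have e2 : Y^T *m A^T *m Y *m Y^T *m S = Y^T *m A^T *m S.
      by rewrite -!mulmxA YYS.
    by rewrite /A' !trmx_mul trmxK !mulmxA e1 e2 -(mulmxA Y^T) SA mulmxA.
  + by rewrite -!mulmxA YB SB.
  + split; first by rewrite mulmxA -hA' -mulmxA AZ.
    by rewrite mulmxA -trmx_mul YB.
- apply: (reachable_similar hA' erefl) rAB => v hv.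
  by rewrite -[v]mulmx1 -oY mulmxA hv mul0mx.
- apply: unitmx_inj => x; rewrite -!mulmxA => hx.
  have SYx : S *m (Y *m x) = 0 by rewrite -YS hx mulmx0.
  have Yx : Y *m x = 0.
    by apply: dot_eq0; rewrite {1}hY -mulmxA dotC dot_adj sS SYx dot0l.
  by rewrite -[x]mul1mx -oY -mulmxA Yx mulmx0.
- by exists Y.
- apply/esym/(@transfer_intertwine _ _ _ _ _ _ _ _ _ _ _ _ Y^T) => //.
  by rewrite -trmx_mul YB.
Qed.

End Reduction.

(** * Structure of the zero dynamics *)

Section ZeroDynamics.
Variable R : realType.

(** As [S] fixes the range of [B], it splits along with the state space.
[A60 Z0 = B6] with [A00 Z0 = 0] will produce the zeros at the origin. *)
Lemma collocated_strip (N m : nat) (A : 'M[R]_N) (B : 'M_(N, m)) S Z :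
  collocated A B S Z -> reachable A B -> S \in unitmx ->
  (forall x : 'cV_m, B *m x = 0 -> x = 0) ->
  exists k (T : 'M[R]_(N, k + m)) (A00 : 'M_k) A06 A60 A66 (B6 : 'M_m) (S0 : 'M_k) Z0,
  [/\ [/\ T *m T^T = 1%:M, T^T *m T = 1%:M, A *m T = T *m block_mx A00 A06 A60 A66,
          B = T *m col_mx 0 B6 & B6 \in unitmx],
      [/\ S0^T = S0, S0 *m A00 = A00^T *m S0, S0 *m A06 = A60^T, A66^T = A66 &
          forall x : 'cV_k, S0 *m x = 0 -> x = 0],
      psd_kyp_solution A00 A06 (- A60) (- A66) 1%:M,
      reachable A00 A06 & A00 *m Z0 = 0 /\ A60 *m Z0 = B6].
Proof.
move=> [kyp sS SA SB [AZ BZ]] rAB uS Binj.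
have [k [r [U0 [U1 [[o0 o1 o01 id1] _ hU0 [L hL]]]]]] := orth_split B.
have UB : U1 *m (U1^T *m B) = B.
  by rewrite -[RHS]mul1mx -id1 mulmxDl -!mulmxA hU0 mulmx0 add0r.
have B6L : U1^T *m B *m L = 1%:M by rewrite -mulmxA -hL.
have rm : r = m.
  apply: (bijective_dim B6L) => x hx; apply: Binj.
  by rewrite -UB -mulmxA hx mulmx0.
subst r; set B6 := U1^T *m B in UB B6L.
have uB6 : B6 \in unitmx by have [] := mulmx1_unit B6L.
pose T := row_mx U0 U1.
have TT : T *m T^T = 1%:M by rewrite /T tr_row_mx mul_row_col.
have T1 : T^T *m T = 1%:M by apply: row_mx_res1.
have TB : B = T *m col_mx 0 B6 by rewrite mul_row_col mulmx0 add0r UB.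
pose A' := T^T *m A *m T.
have AT : A *m T = T *m A' by rewrite /A' !mulmxA TT mul1mx.
have TA : T^T *m A = A' *m T^T by rewrite /A' -!mulmxA TT mulmx1.
have A'E : A' = block_mx (ulsubmx A') (ursubmx A') (dlsubmx A') (drsubmx A').
  by rewrite submxK.
have TBE : T^T *m B = col_mx 0 B6 by rewrite {1}TB mulmxA T1 mul1mx.
have SU1 : S *m U1 = U1 by rewrite {1}hL mulmxA SB -hL.
pose S0 := U0^T *m S *m U0.
have S1 : T^T *m S *m T = block_mx S0 0 0 1%:M.
  rewrite /T tr_row_mx mul_col_mx mul_col_row -!(mulmxA _ S U1) SU1 o01 o1.
  congr block_mx; apply: trmx_inj.
  by rewrite !trmx_mul trmxK sS mulmxA -mulmxA SU1 o01 trmx0.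
have S1A : block_mx S0 0 0 1%:M *m A' = A'^T *m block_mx S0 0 0 1%:M.
  rewrite -S1 /A' !trmx_mul trmxK.
  rewrite -!mulmxA !(mulmxA T T^T) TT !mul1mx.
  by rewrite (mulmxA S) SA !mulmxA.
move: (S1A); rewrite A'E tr_block_mx !mulmx_block !mul0mx !mulmx0 !mul1mx !mulmx1.
rewrite !addr0 !add0r => /eq_block_mx[s1 s2 _ s4].
have rA' : reachable A' (col_mx 0 B6).
  apply: (reachable_similar TA TBE) rAB => v hv.
  by rewrite -[v]mulmx1 -T1 mulmxA hv mul0mx.
have kyp' : psd_kyp_solution A' (col_mx 0 B6) (col_mx 0 B6)^T 0 1%:M.
  rewrite -T1 -[T^T]mulmx1; apply: kyp_similar kyp => //.
  by rewrite TB trmx_mul -mulmxA T1 mulmx1.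
pose Z0 := U0^T *m Z.
have Z6 : U1^T *m Z = 0.
  have : B6^T *m (U1^T *m Z) = 0 by rewrite mulmxA -trmx_mul UB.
  move=> /(congr1 (mulmx (invmx B6^T))); rewrite mulKmx ?unitmx_tr // mulmx0 //.
have TZ : T^T *m Z = col_mx Z0 0 by rewrite /T tr_row_mx mul_col_mx Z6.
have : A' *m col_mx Z0 0 = col_mx 0 B6 by rewrite -TZ mulmxA -TA -mulmxA AZ.
rewrite A'E mul_block_col !mulmx0 !addr0 => /eq_col_mx[z0 z6].
exists k, T, (ulsubmx A'), (ursubmx A'), (dlsubmx A'), (drsubmx A'), B6, S0, Z0.
split=> //.
- by rewrite -A'E.
- split=> // [|x hx]; first by rewrite !trmx_mul trmxK sS mulmxA.
  have : S *m (T *m col_mx x 0) = 0.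
    rewrite -[LHS]mul1mx -TT -mulmxA (mulmxA T^T) (mulmxA _ T) S1.
    by rewrite mul_block_col hx !mul0mx !mulmx0 !addr0 col_mx0 mulmx0.
  move=> /(congr1 (mulmx (invmx S))); rewrite mulKmx // mulmx0.
  move=> /(congr1 (mulmx T^T)); rewrite mulmxA T1 mul1mx mulmx0 => /eqP.
  by rewrite col_mx_eq0 => /andP[/eqP].
- have /(kyp_strip _ _ _ _ _ uB6)[P0 e h] : psd_kyp_solution (block_mx
      (ulsubmx A') (ursubmx A') (dlsubmx A') (drsubmx A')) (col_mx 0 B6)
      (col_mx 0 B6)^T 0 1%:M by rewrite -A'E.
  have [e0 _ _ _] := eq_block_mx (etrans (esym (scalar_mx_block k m 1)) e).
  by rewrite e0.
- by apply: (@reachable_strip _ _ _ _ _ (dlsubmx A') (drsubmx A') B6); rewrite -A'E.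
Qed.

(** The two parts are decoupled by the form as well, because its cross term
solves a Sylvester equation. On the conservative part the square of the form
commutes with [J] and fixes the inputs, so it is the identity by reachability. *)
Lemma collocated_split (k m : nat) (A00 : 'M[R]_k) (A06 : 'M_(k, m)) C0 D0 S0 Z0
    (B6 : 'M_m) :
  S0^T = S0 -> S0 *m A00 = A00^T *m S0 -> S0 *m A06 = - C0^T ->
  (forall x : 'cV_k, S0 *m x = 0 -> x = 0) ->
  psd_kyp_solution A00 A06 C0 D0 1%:M -> reachable A00 A06 ->
  A00 *m Z0 = 0 -> - C0 *m Z0 = B6 ->
  exists r p (W : 'M[R]_(k, r + p)) (J : 'M_r) (Az : 'M_p) Bj Bz Cz Sj Sz y,
  [/\ [/\ W^T *m W = 1%:M, W *m W^T = 1%:M, A00 *m W = W *m block_mx J 0 0 Az,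
        A06 = W *m col_mx Bj Bz & C0 *m W = row_mx Bj^T Cz],
      [/\ J^T = - J, reachable J Bj, Sj^T = Sj & Sj *m Sj = 1%:M],
      [/\ Sj *m J = - (J *m Sj), Sj *m Bj = - Bj, J *m y = 0 & Bj^T *m y = - B6],
      [/\ damped Az, reachable Az Bz & psd_kyp_solution Az Bz Cz D0 1%:M]
    & [/\ Sz^T = Sz, Sz *m Az = Az^T *m Sz, Sz *m Bz = - Cz^T &
          forall x : 'cV_p, Sz *m x = 0 -> x = 0]].
Proof.
move=> sS SA SB Sinj kyp rAB AZ CZ.
have dA : psdmx (- (A00 + A00^T)).
  apply/psdmxP; split=> [|x]; first by rewrite linearN linearD /= trmxK addrC.
  have [_ /(_ x 0)] := (kyp_dissipation _ _ _ _ _).1 kyp.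
  rewrite mul1mx mulmx0 addr0 dot0l mulNmx mulmxDl dotNr dotDr (dot_adj A00^T).
  by rewrite trmxK (dotC (A00 *m x)) => h; lra.
have [r [p [U [V [J [Az [[oU oV oUV id1] AU AV sJ dAz]]]]]]] := dissipative_split dA.
have oVU : V^T *m U = 0 by apply: trmx_inj; rewrite trmx_mul trmxK oUV trmx0.
pose Bj := U^T *m A06; pose Bz := V^T *m A06; pose Cz := C0 *m V.
pose Sj := U^T *m S0 *m U; pose Sz := V^T *m S0 *m V; pose y := U^T *m Z0.
have UJ : U^T *m A00 *m U = J by rewrite -mulmxA AU mulmxA oU mul1mx.
have VAz : V^T *m A00 *m V = Az by rewrite -mulmxA AV mulmxA oV mul1mx.
have UA : U^T *m A00 = J *m U^T.
  rewrite -[LHS]mulmx1 -id1 mulmxDr !mulmxA UJ -(mulmxA U^T) AV !mulmxA oUV.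
  by rewrite !mul0mx addr0.
have VA : V^T *m A00 = Az *m V^T.
  rewrite -[LHS]mulmx1 -id1 mulmxDr !mulmxA VAz -(mulmxA V^T) AU !mulmxA oVU.
  by rewrite !mul0mx add0r.
have C0U : C0 *m U = Bj^T.
  apply: eq_mulmx_cV => x.
  have [|_] := @kyp_lossless _ _ _ _ _ _ _ 1%:M (U *m x) 0 kyp.
    rewrite mul1mx !mulmx0 addr0 dot0l mulmxA AU -mulmxA dot_adj mulmxA oU mul1mx.
    by rewrite skew_form.
  rewrite mulmx0 addr0 mulmx1 mulmxBl => /eqP; rewrite subr_eq0 => /eqP.
  by rewrite !mulmxA => <-; rewrite /Bj trmx_mul trmxK.
have W1 : (row_mx U V)^T *m row_mx U V = 1%:M by apply: row_mx_res1.
have W2 : row_mx U V *m (row_mx U V)^T = 1%:M by rewrite tr_row_mx mul_row_col.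
have AW : A00 *m row_mx U V = row_mx U V *m block_mx J 0 0 Az.
  by rewrite mul_mx_row AU AV mul_row_block !mulmx0 addr0 add0r.
have BW : A06 = row_mx U V *m col_mx Bj Bz.
  by rewrite mul_row_col /Bj /Bz !mulmxA -mulmxDl id1 mul1mx.
have rW : reachable (block_mx J 0 0 Az) (col_mx Bj Bz).
  apply: (@reachable_similar _ _ _ _ _ _ _ _ (row_mx U V)^T) rAB.
  - rewrite -[LHS]mulmx1 -W2 -!mulmxA (mulmxA A00) AW -!mulmxA.
    by rewrite (mulmxA _ (row_mx U V)) W1 mul1mx.
  - by rewrite BW mulmxA W1 mul1mx.
  - by move=> v hv; rewrite -[v]mulmx1 -W1 mulmxA hv mul0mx.
have [rJ rAz] := reachable_split rW.
have SUV : U^T *m S0 *m V = 0.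
  apply: (@damped_skew_sylvester _ _ _ Az (- J)) => //.
    by rewrite linearN /= sJ.
  rewrite -sJ -mulmxA -AV mulmxA -(mulmxA U^T) SA (mulmxA U^T).
  by rewrite -[U^T *m A00^T]trmx_mul AU trmx_mul !mulmxA.
have SVU : V^T *m S0 *m U = 0.
  by apply: trmx_inj; rewrite !trmx_mul trmxK sS mulmxA SUV trmx0.
have SJJ : Sj *m J = - (J *m Sj).
  rewrite /Sj -mulmxA -AU mulmxA -(mulmxA U^T) SA (mulmxA U^T).
  by rewrite -[U^T *m A00^T]trmx_mul AU trmx_mul sJ mulNmx !mulmxA mulNmx !mulNmx.
have SjE : U^T *m S0 = Sj *m U^T.
  by rewrite -[LHS]mulmx1 -id1 mulmxDr !mulmxA SUV mul0mx addr0.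
have SzE : V^T *m S0 = Sz *m V^T.
  by rewrite -[LHS]mulmx1 -id1 mulmxDr !mulmxA SVU mul0mx add0r.
have SBj : Sj *m Bj = - Bj.
  rewrite /Bj mulmxA -SjE -mulmxA SB mulmxN -trmx_mul C0U trmxK //.
have sSj : Sj^T = Sj by rewrite !trmx_mul trmxK sS mulmxA.
have SS : Sj *m Sj = 1%:M.
  apply/eqP; rewrite -subr_eq0; apply/eqP; apply: (reachable_mx rJ) => i.
  have c : (Sj *m Sj - 1%:M) *m J = J *m (Sj *m Sj - 1%:M).
    rewrite mulmxBl mulmxBr mul1mx mulmx1 -mulmxA SJJ mulmxN mulmxA SJJ mulNmx opprK.
    by rewrite (mulmxA J Sj Sj).
  rewrite -(intertwine_exp i (esym c)) -mulmxA mulmxBl mul1mx -mulmxA SBj.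
  by rewrite mulmxN SBj opprK subrr mulmx0.
have VZ : V^T *m Z0 = 0.
  apply: eq_mulmx_cV => x; rewrite mul0mx; apply: (damped_inj dAz).
  by rewrite !mulmxA -VA -(mulmxA V^T) AZ mulmx0 mul0mx.
have Uy : U *m y = Z0.
  by rewrite -[RHS]mul1mx -id1 mulmxDl -!mulmxA VZ mulmx0 addr0.
exists r, p, (row_mx U V), J, Az, Bj, Bz, Cz, Sj, Sz, y; split=> //; split=> //.
- by rewrite mul_mx_row C0U.
- by rewrite /y mulmxA -UA -mulmxA AZ mulmx0.
- by rewrite -C0U -mulmxA Uy -CZ mulNmx opprK.
- by rewrite -VAz; apply: kyp_compress.
- by rewrite !trmx_mul trmxK sS mulmxA.
- rewrite /Sz -mulmxA -AV mulmxA -(mulmxA V^T) SA (mulmxA V^T).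
  by rewrite -[V^T *m A00^T]trmx_mul AV trmx_mul !mulmxA.
- by rewrite /Bz mulmxA -SzE -mulmxA SB mulmxN /Cz trmx_mul.
- move=> x hx; have : S0 *m (V *m x) = 0.
    rewrite -[LHS]mul1mx -id1 mulmxDl -!mulmxA !(mulmxA _ S0) !(mulmxA (_ *m S0)).
    by rewrite SUV -/Sz hx mul0mx !mulmx0 addr0.
  by move=> /Sinj h; rewrite -[x]mul1mx -oV -mulmxA h mulmx0.
Qed.

End ZeroDynamics.

(** * Block form of the conservative part and simultaneous diagonalization *)

Section Balancing.
Variable R : realType.

Lemma eq_opp_mx0 (p q : nat) (M : 'M[R]_(p, q)) : M = - M -> M = 0.
Proof.
move=> h; apply/matrixP=> i j; have /matrixP/(_ i j) := h; rewrite !mxE => e.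
lra.
Qed.

(** Coordinates for the conservative part. The involution [S] exchanges sign
with [J], so [J] maps its two eigenspaces into each other, and the inputs lie in
the eigenspace for [-1]. By reachability [J] is injective on the other one; the
kernel of [J] is thus contained in the eigenspace for [-1], and its dimension is
the number of inputs because of the equilibrium [y]. *)
Lemma conservative_blocks (r m : nat) (J S : 'M[R]_r) (B : 'M_(r, m)) y
    (B6 : 'M_m) :
  J^T = - J -> reachable J B -> S^T = S -> S *m S = 1%:M ->
  S *m J = - (J *m S) -> S *m B = - B -> J *m y = 0 -> B^T *m y = - B6 ->
  B6 \in unitmx ->
  exists l (W : 'M[R]_(r, m + l)) (V : 'M[R]_(r, l)) (A16 : 'M_m) (A25 : 'M_l)
      (A26 : 'M_(l, m)),
  [/\ [/\ W^T *m W = 1%:M, V^T *m V = 1%:M, W^T *m V = 0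
        & W *m W^T + V *m V^T = 1%:M],
      J *m W = - (V *m row_mx 0 A25^T), J *m V = W *m col_mx 0 A25,
      B = W *m col_mx A16 A26 & A16 \in unitmx].
Proof.
move=> sJ rJ sS SS SJ SB Jy By uB6.
have [a [l [U [V [[oU oV oUV id1] _ hU [L hV]]]]]] := orth_split (1%:M + S).
have US : U^T *m S = - U^T.
  by apply/eqP; rewrite -subr_eq0 opprK addrC -{1}[U^T]mulmx1 -mulmxDr hU.
have SU : S *m U = - U.
  by apply: trmx_inj; rewrite trmx_mul sS US linearN.
have SV : S *m V = V by rewrite hV mulmxA mulmxDr mulmx1 SS addrC.
have VS : V^T *m S = V^T by rewrite -{1}sS -trmx_mul SV.
have UJU : U^T *m J *m U = 0.
  have e : U^T *m (S *m J) *m U = - (U^T *m J *m U) by rewrite mulmxA US !mulNmx.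
  apply: eq_opp_mx0; rewrite -e SJ mulmxN mulNmx mulmxA -(mulmxA _ S) SU.
  by rewrite mulmxN opprK.
have VJV : V^T *m J *m V = 0.
  have e : V^T *m (S *m J) *m V = V^T *m J *m V by rewrite mulmxA VS.
  by apply: eq_opp_mx0; rewrite -{1}e SJ mulmxN mulNmx mulmxA -(mulmxA _ S) SV.
have VB : V^T *m B = 0.
  by apply: eq_opp_mx0; rewrite -{1}VS -mulmxA SB mulmxN.
pose X := U^T *m J *m V; pose b := U^T *m B.
have VJU : V^T *m J *m U = - X^T.
  by rewrite /X !trmx_mul trmxK sJ mulNmx mulmxN opprK mulmxA.
have JV : J *m V = U *m X.
  by rewrite -[LHS]mul1mx -id1 mulmxDl -!mulmxA (mulmxA V^T) VJV mulmx0 addr0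
     /X !mulmxA.
have JU : J *m U = - (V *m X^T).
  rewrite -[LHS]mul1mx -id1 mulmxDl -!mulmxA !(mulmxA _ J) UJU VJU mulmx0 add0r.
  by rewrite mulmxN.
have Bb : B = U *m b.
  by rewrite -[LHS]mul1mx -id1 mulmxDl -!mulmxA VB mulmx0 addr0.
have UJ : U^T *m J = X *m V^T.
  by apply: trmx_inj; rewrite trmx_mul trmxK sJ mulNmx JU opprK [RHS]trmx_mul trmxK.
have [m' [l' [V0 [V1 [[o0 o1 o01 id2] _ hV0 [L1 hV1]]]]]] := orth_split X.
pose A25 := V1^T *m X; pose A16 := V0^T *m b; pose A26 := V1^T *m b.
have XE : X = V1 *m A25.
  by rewrite -[LHS]mul1mx -id2 mulmxDl -!mulmxA hV0 mulmx0 add0r.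
have unreach (v : 'rV_r) : v *m J = 0 -> v *m B = 0 -> v = 0.
  move=> vJ vB; apply: rJ => -[|k]; first by rewrite expr0 mulmx1.
  by rewrite expmxS mulmxA vJ !mul0mx.
have el : l' = l.
  apply: (@bijective_dim _ _ _ A25 L1) => [|x hx].
    by rewrite /A25 -mulmxA -hV1.
  have Vx : (V *m x)^T = 0.
    apply: unreach; rewrite trmx_mul -mulmxA.
      have -> : V^T *m J = - (X^T *m U^T).
        apply: trmx_inj; rewrite linearN /= -trmx_mul trmxK trmx_mul trmxK.
        by rewrite sJ mulNmx JV.
      by rewrite mulmxN mulmxA -trmx_mul XE -mulmxA hx mulmx0 trmx0 mul0mx oppr0.
    by rewrite VB mulmx0.
  by rewrite -[x]mul1mx -oV -mulmxA -[V *m x]trmxK Vx trmx0 mulmx0.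
have Xw : X^T *m (U^T *m y) = 0.
  rewrite mulmxA -trmx_mul -JV trmx_mul sJ mulmxN mulNmx -mulmxA Jy mulmx0.
  by rewrite oppr0.
have w0 : U^T *m y = V0 *m (V0^T *m (U^T *m y)).
  rewrite -[LHS]mul1mx -id2 mulmxDl -!mulmxA [X in _ + V1 *m X](_ : _ = 0).
    by rewrite mulmx0 addr0.
  by rewrite hV1 trmx_mul -mulmxA Xw mulmx0.
have A16y : A16^T *m (V0^T *m (U^T *m y)) = - B6.
  rewrite /A16 trmx_mul trmxK -mulmxA -w0 mulmxA -trmx_mul -By.
  by rewrite [in RHS]Bb.
have A16B : A16^T *m (V0^T *m (U^T *m y) *m - invmx B6) = 1%:M.
  by rewrite mulmxA A16y mulNmx mulmxN opprK mulmxV.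
have em : m = m'.
  apply: (bijective_dim A16B).
  move=> x hx; have : (U *m (V0 *m x))^T = 0.
    apply: unreach; rewrite !trmx_mul -!mulmxA.
      by rewrite UJ (mulmxA V0^T) hV0 mul0mx mulmx0.
    by rewrite -/b -/A16 -[A16]trmxK -trmx_mul hx trmx0.
  move=> h; rewrite -[x]mul1mx -o0 -[V0^T *m V0]mul1mx.
  rewrite mul1mx -mulmxA -[V0 *m x]mul1mx -oU -mulmxA -[U *m _]trmxK h.
  by rewrite trmx0 !mulmx0.
subst l' m'.
have uA16 : A16 \in unitmx by rewrite -unitmx_tr;
  by have [] := mulmx1_unit A16B.
exists l, (row_mx (U *m V0) (U *m V1)), V, A16, A25, A26.
have oo p q (M : 'M_(a, p)) (M' : 'M_(a, q)) :
    (U *m M)^T *m (U *m M') = M^T *m M'.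
  by rewrite trmx_mul -mulmxA (mulmxA U^T) oU mul1mx.
split=> //.
- split=> //.
  + by apply: row_mx_res1; rewrite oo ?o0 ?o1 ?o01.
  + by rewrite tr_row_mx mul_col_mx !trmx_mul -!mulmxA oUV !mulmx0 col_mx0.
  + rewrite tr_row_mx mul_row_col !trmx_mul !mulmxA -mulmxDl.
    by rewrite -!(mulmxA U) -mulmxDr id2 mulmx1.
- rewrite mul_mx_row !mulmxA JU !mulNmx mul_mx_row opp_row_mx mulmx0.
  rewrite -!(mulmxA V) -[X^T *m V0]trmxK trmx_mul trmxK hV0 trmx0 mulmx0.
  by rewrite [A25^T]trmx_mul trmxK.
- by rewrite mul_row_col mulmx0 add0r JV {1}XE mulmxA.
- rewrite mul_row_col -!mulmxA -mulmxDr {1}Bb; congr (_ *m _).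
  by rewrite /A16 /A26 (mulmxA V0) (mulmxA V1) -mulmxDl id2 mul1mx.
Qed.

(** Spectral theorem in coordinates in which [P] is the identity; then scaling by
the inverse square roots of the absolute eigenvalues of [S]. *)
Lemma balance_forms (p : nat) (P S : 'M[R]_p) : spdmx P -> S^T = S ->
  (forall x : 'cV_p, S *m x = 0 -> x = 0) ->
  exists p1 p2 (T : 'M[R]_(p, p1 + p2)) (T' : 'M_(p1 + p2, p))
      (d : 'rV_(p1 + p2)),
  [/\ T *m T' = 1%:M, T' *m T = 1%:M, forall i, 0 < d 0 i,
      T^T *m P *m T = diag_mx d
    & T^T *m S *m T = block_mx (- 1%:M) 0 0 1%:M].
Proof.
move=> hP sS Sinj; have [T0 uT0 hT0] := spd_congr1 hP.
have [||p1 [p2 [T1 [T2 [d1 [d2 [[o1 o2 o12 id1] h1 h2 s1 s2]]]]]]] :=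
  @sym_spectral _ _ (T0^T *m S *m T0).
- by rewrite !trmx_mul trmxK sS mulmxA.
- move=> x; rewrite -!mulmxA => hx.
  rewrite -(mulKmx uT0 x) (_ : T0 *m x = 0) ?mulmx0 //; apply: Sinj.
  by rewrite -(mulKmx (_ : T0^T \in unitmx) (S *m _)) ?unitmx_tr // hx mulmx0.
pose V := row_mx T1 T2; pose dd := row_mx d1 d2.
have ddp i : 0 < dd 0 i by rewrite mxE; case: split.
have V1 : V^T *m V = 1%:M by apply: row_mx_res1.
have V2 : V *m V^T = 1%:M by rewrite tr_row_mx mul_row_col.
pose q : 'rV[R]_(p1 + p2) := \row_i Num.sqrt (dd 0 i).
pose s : 'rV[R]_(p1 + p2) := \row_i (Num.sqrt (dd 0 i))^-1.
have qE i : q 0 i = Num.sqrt (dd 0 i) by rewrite mxE.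
have sE i : s 0 i = (Num.sqrt (dd 0 i))^-1 by rewrite mxE.
have qN0 i : Num.sqrt (dd 0 i) != 0 by rewrite gt_eqF // sqrtr_gt0.
have dmul (u w : 'rV[R]_(p1 + p2)) :
    diag_mx u *m diag_mx w = diag_mx (\row_i (u 0 i * w 0 i)).
  by rewrite mul_diag_mx; apply/matrixP=> i j; rewrite !mxE;
     case: eqVneq => [->|_]; rewrite ?mulr1n ?mulr0n ?mulr0.
have one (u : 'rV[R]_(p1 + p2)) : (forall i, u 0 i = 1) -> diag_mx u = 1%:M.
  by move=> h; apply/matrixP=> i j; rewrite !mxE h.
have sq : diag_mx s *m diag_mx q = 1%:M.
  by rewrite dmul; apply: one => i; rewrite mxE qE sE mulVf.
have qs : diag_mx q *m diag_mx s = 1%:M.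
  by rewrite dmul; apply: one => i; rewrite mxE qE sE mulfV.
have cong M : (T0 *m V *m diag_mx s)^T *m M *m (T0 *m V *m diag_mx s) =
    diag_mx s *m (V^T *m (T0^T *m M *m T0 *m V)) *m diag_mx s.
  by rewrite !trmx_mul tr_diag_mx !mulmxA.
exists p1, p2, (T0 *m V *m diag_mx s), (diag_mx q *m V^T *m invmx T0),
  (\row_i (dd 0 i)^-1); split.
- rewrite -!mulmxA (mulmxA (diag_mx s)) sq mul1mx (mulmxA V) V2 mul1mx.
  by rewrite mulmxV.
- by rewrite -!mulmxA mulKmx // (mulmxA V^T) V1 mul1mx qs.
- by move=> i; rewrite mxE invr_gt0.
- rewrite cong hT0 mul1mx V1 mulmx1 dmul; congr diag_mx; apply/rowP=> i.
  by rewrite [LHS]mxE [RHS]mxE sE -invfM -expr2 sqr_sqrtr // ltW.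
rewrite cong.
have -> : T0^T *m S *m T0 *m V = V *m diag_mx (row_mx (- d1) d2).
  rewrite mul_mx_row s1 s2 diag_mx_row mul_row_block !mulmx0 addr0 add0r.
  by rewrite linearN /= mulmxN.
rewrite (mulmxA V^T V) V1 mul1mx !dmul.
have -> : block_mx (- 1%:M) 0 0 1%:M =
    diag_mx (row_mx (const_mx (-1)) (const_mx 1)) :> 'M[R]_(p1 + p2).
  by rewrite diag_mx_row !diag_const_mx raddfN.
congr diag_mx; apply/rowP=> i; rewrite !mxE.
have e : (Num.sqrt (dd 0 i))^-1 * dd 0 i * (Num.sqrt (dd 0 i))^-1 = 1.
  have := qN0 i; have : Num.sqrt (dd 0 i) ^+ 2 = dd 0 i by rewrite sqr_sqrtr // ltW.
  by move: (Num.sqrt _) => t <- t0; field.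
move: e; rewrite mxE; case: split => j; rewrite !mxE // => e.
by rewrite mulrN mulNr e.
Qed.

(** The symmetry [S] is a change of coordinates from the system to its dual, and
it preserves a storage with which it commutes. *)
Lemma minimal_kyp_dual (N m : nat) (A S : 'M[R]_N) (B : 'M_(N, m)) C D P :
  S *m S = 1%:M -> S^T = S -> S *m A = A^T *m S -> S *m B = C^T -> D^T = D ->
  S *m P = P *m S ->
  minimal_kyp_solution A B C D P -> minimal_kyp_solution A^T C^T B^T D^T P.
Proof.
move=> SS sS SA SB sD SP h; rewrite sD.
have -> : P = S^T *m P *m S by rewrite sS SP -mulmxA SS mulmx1.
apply: (minimal_kyp_similar SS SS) h.
- by rewrite -[LHS]mul1mx -SS -!mulmxA (mulmxA S A) SA -!mulmxA SS mulmx1.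
- by rewrite -SB mulmxA SS mul1mx.
- by rewrite -[C]trmxK -SB trmx_mul sS -mulmxA SS mulmx1.
Qed.

(** The inverse of the dual minimal solution also solves the KYP inequality, so
that [diag_mx d] lies below its own inverse. *)
Lemma balanced_le1 (N m : nat) (A : 'M[R]_N) (B : 'M_(N, m)) C D
    (d : 'rV_N) :
  (forall i, 0 < d 0 i) -> minimal_kyp_solution A B C D (diag_mx d) ->
  minimal_kyp_solution A^T C^T B^T D^T (diag_mx d) -> forall i, d 0 i <= 1.
Proof.
move=> dp [hP hmin] [hQ _] i.
have diagE (u : 'rV[R]_N) x : dot x (diag_mx u *m x) = \sum_j u 0 j * x j 0 ^+ 2.
  rewrite mul_diag_mx dotE; apply: eq_bigr => j _; rewrite mxE; ring.
have spd : spdmx (diag_mx d).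
  apply: psd_spd; first by case: hP.
  move=> x hx; apply/matrixP=> j k; have /matrixP/(_ j k) := hx.
  by rewrite mul_diag_mx !mxE => /eqP; rewrite mulf_eq0 gt_eqF //= => /eqP.
have inv : invmx (diag_mx d) = diag_mx (\row_j (d 0 j)^-1).
  rewrite -[RHS](mulKmx (spd_unit spd)) mul_diag_mx -[LHS]mulmx1; congr (_ *m _).
  apply/matrixP=> j k; rewrite !mxE.
  by case: eqVneq => [->|_]; rewrite ?mulr1n ?mulr0n ?mulr0 // mulfV // gt_eqF.
have := hmin _ (kyp_dual_inv spd hQ); rewrite inv.
move=> /(lemxP (tr_diag_mx _) (tr_diag_mx _)).1/(_ (delta_mx i 0)).
rewrite !diagE (bigD1 i) //= [X in _ + X]big1 => [|j ji]; last first.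
  by rewrite !mxE (negbTE ji) expr0n mulr0.
rewrite [X in _ <= X](bigD1 i) //= [X in _ <= _ + X]big1 => [|j ji]; last first.
  by rewrite !mxE (negbTE ji) expr0n mulr0.
rewrite !mxE !eqxx !addr0 expr1n !mulr1 => h; rewrite leNgt; apply/negP=> d1.
have : d 0 i * d 0 i <= 1 by rewrite -(mulfV (lt0r_neq0 (dp i))) ler_pM2l.
by nra.
Qed.

(** The distinct diagonal entries serve as the values, and the position of an
entry in their list as its block. *)
Lemma diag_balanced (N m : nat) (A : 'M[R]_N) (B : 'M_(N, m)) C D
    (d : 'rV_N) :
  (forall i, 0 < d 0 i) -> minimal_kyp_solution A B C D (diag_mx d) ->
  minimal_kyp_solution A^T C^T B^T D^T (diag_mx d) ->
  positive_real_balanced A B C D.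
Proof.
move=> dp h1 h2; have d1 := balanced_le1 dp h1 h2.
pose s := undup [seq d 0 i | i : 'I_N].
have ms i : d 0 i \in s by rewrite mem_undup; apply/mapP; exists i; rewrite ?mem_enum.
have lt i : (index (d 0%R i) s < size s)%N by rewrite index_mem.
exists (size s), (fun k => nth 0 s k), (fun i => Ordinal (lt i)).
have -> : \row_i nth 0 s (Ordinal (lt i)) = d.
  by apply/rowP=> i; rewrite mxE /= nth_index.
split=> //.
  move=> k k' /eqP; rewrite nth_uniq ?undup_uniq // => /eqP; exact: val_inj.
move=> k; have : nth 0 s k \in s by apply: mem_nth.
by rewrite mem_undup => /mapP[i _ ->]; rewrite dp d1.
Qed.

End Balancing.

(** * Similar systems and the canonical system *)

Section Similarity.
Variable R : realType.

Definition similar_by (N N' m p : nat) (T : 'M[R]_(N, N')) (T' : 'M[R]_(N', N))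
    (A : 'M[R]_N) (B : 'M_(N, m)) (C : 'M_(p, N))
    (A' : 'M[R]_N') (B' : 'M_(N', m)) (C' : 'M_(p, N')) : Prop :=
  [/\ T *m T' = 1%:M, T' *m T = 1%:M, A *m T = T *m A', B = T *m B'
    & C *m T = C'].

Lemma similar_sym (N N' m p : nat) (T : 'M_(N, N')) (T' : 'M_(N', N))
    (A : 'M[R]_N) (B : 'M_(N, m)) (C : 'M_(p, N)) A' B' C' :
  similar_by T T' A B C A' B' C' -> similar_by T' T A' B' C' A B C.
Proof.
move=> [TT' T'T hA hB hC]; split=> //.
- by rewrite -[LHS]mul1mx -T'T -!mulmxA (mulmxA T A') -hA -!mulmxA TT' mulmx1.
- by rewrite hB mulmxA T'T mul1mx.
- by rewrite -hC -mulmxA TT' mulmx1.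
Qed.

Lemma similar_trans (N N' N'' m p : nat) (T : 'M_(N, N')) (T' : 'M_(N', N))
    (U : 'M_(N', N'')) (U' : 'M_(N'', N'))
    (A : 'M[R]_N) (B : 'M_(N, m)) (C : 'M_(p, N)) A' B' C' A'' B'' C'' :
  similar_by T T' A B C A' B' C' -> similar_by U U' A' B' C' A'' B'' C'' ->
  similar_by (T *m U) (U' *m T') A B C A'' B'' C''.
Proof.
move=> [t1 t2 hA hB hC] [u1 u2 hA' hB' hC']; split.
- by rewrite -mulmxA (mulmxA U) u1 mul1mx.
- by rewrite -mulmxA (mulmxA T') t2 mul1mx.
- by rewrite mulmxA hA -mulmxA hA' mulmxA.
- by rewrite hB hB' mulmxA.
- by rewrite mulmxA hC hC'.
Qed.

Lemma similar_reachable (N N' m p : nat) (T : 'M_(N, N')) (T' : 'M_(N', N))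
    (A : 'M[R]_N) (B : 'M_(N, m)) (C : 'M_(p, N)) A' B' C' :
  similar_by T T' A B C A' B' C' -> reachable A B -> reachable A' B'.
Proof.
move=> /similar_sym[T'T _ hA hB _].
apply: (@reachable_similar _ _ _ _ _ _ _ _ T') => // v hv.
by rewrite -[v]mulmx1 -T'T mulmxA hv mul0mx.
Qed.

Lemma similar_rank_pencil (K : fieldType) (f : {rmorphism R -> K})
    (N N' m p : nat) (T : 'M_(N, N')) (T' : 'M_(N', N))
    (A : 'M[R]_N) (B : 'M_(N, m)) (C : 'M_(p, N)) (D : 'M_(p, m)) A' B' C' (s : K) :
  similar_by T T' A B C A' B' C' ->
  \rank (pencil s (map_mx f A) (map_mx f B) (map_mx f C) (map_mx f D)) =
  \rank (pencil s (map_mx f A') (map_mx f B') (map_mx f C') (map_mx f D)).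
Proof.
move=> [TT' T'T hA hB hC].
apply: (@pencil_similar _ _ _ _ _ _ _ _ _ _ _ _ _ (map_mx f T) (map_mx f T'));
  by rewrite -?map_mxM ?TT' ?T'T ?hA ?hC ?map_mx1 // -hB.
Qed.

Lemma is_zero_similar (N N' m p : nat) (T : 'M_(N, N')) (T' : 'M_(N', N))
    (A : 'M[R]_N) (B : 'M_(N, m)) (C : 'M_(p, N)) D A' B' C' z :
  similar_by T T' A B C A' B' C' -> (is_zero A B C D z <-> is_zero A' B' C' D z).
Proof.
move=> h; rewrite /is_zero /toCmx (similar_rank_pencil _ _ _ h).
have := similar_rank_pencil (@tofrac _ \o polyC) D (tofrac 'X) h.
by rewrite /toFmx => ->.
Qed.

Lemma eigenvalue_unit (F : fieldType) (N : nat) (A : 'M[F]_N) z :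
  eigenvalue A z = ((z%:M - A) \notin unitmx).
Proof.
rewrite /eigenvalue /eigenspace kermx_eq0 row_free_unit.
by rewrite -opprB -scaleN1r unitmxZ ?unitrN1.
Qed.

Lemma eigenvalue_similar (N N' m p : nat) (T : 'M_(N, N')) (T' : 'M_(N', N))
    (A : 'M[R]_N) (B : 'M_(N, m)) (C : 'M_(p, N)) A' B' C' z :
  similar_by T T' A B C A' B' C' -> eigenvalue (toCmx A') z ->
  eigenvalue (toCmx A) z.
Proof.
move=> /similar_sym[TT' T'T hA _ _] /eigenvalueP[v hv vN0]; apply/eigenvalueP.
exists (v *m toCmx T').
  by rewrite -mulmxA -map_mxM -hA map_mxM mulmxA hv -scalemxAl.
apply: contra vN0 => /eqP h.
by rewrite -[v]mulmx1 -(map_mx1 (real_complex R)) -TT' map_mxM mulmxA h mul0mx.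
Qed.

End Similarity.

Section Canonical.
Variable R : realType.

(** The inverse system consists of a polynomial part, the conservative part [J]
and the damped part [A]; this is the system that results from them. *)
Definition canon (r p m : nat) (J : 'M[R]_r) (A : 'M[R]_p) (Bj : 'M[R]_(r, m))
    (B : 'M[R]_(p, m)) (C : 'M[R]_(m, p)) (A66 : 'M[R]_m) : 'M[R]_((r + p) + m) :=
  block_mx (block_mx J 0 0 A) (col_mx Bj B) (- row_mx Bj^T C) A66.

(** The solution set of the KYP inequality of the whole system is that of the
damped part, padded with identities. *)
Lemma canon_minimal_kyp (r p m : nat) (J : 'M[R]_r) (A : 'M_p) (Bj : 'M_(r, m))
    (B : 'M_(p, m)) C A66 (B6 : 'M_m) P :
  B6 \in unitmx -> J^T = - J -> damped A -> reachable J Bj ->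
  minimal_kyp_solution A B C (- A66) P ->
  minimal_kyp_solution (canon J A Bj B C A66) (col_mx 0 B6) (col_mx 0 B6)^T 0
    (block_mx (block_mx 1%:M 0 0 P) 0 0 1%:M).
Proof.
move=> uB sJ dA rJ [hP hmin]; split.
  apply/(kyp_strip _ _ _ _ _ uB); exists (block_mx 1%:M 0 0 P) => //.
  by rewrite opprK; apply/(kyp_split _ _ _ _ sJ dA rJ); exists P.
move=> P' /(kyp_strip _ _ _ _ _ uB)[P0 ->]; rewrite opprK.
move=> /(kyp_split _ _ _ _ sJ dA rJ)[Pz -> /hmin h].
rewrite /lemx opp_block_mx add_block_mx !oppr0 !addr0 subrr.
apply/psd_block_diag; split; last first.
  by apply/psdmxP; split=> [|x]; rewrite ?trmx0 // mul0mx dot0r.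
rewrite opp_block_mx add_block_mx !oppr0 !addr0 subrr.
apply/psd_block_diag; split=> //.
by apply/psdmxP; split=> [|x]; rewrite ?trmx0 // mul0mx dot0r.
Qed.

(** The normal rank is full, since the pencil of the zero dynamics is invertible
over the rational functions. *)
Lemma canon_is_zero (r p m : nat) (J : 'M[R]_r) (A : 'M_p) (Bj : 'M_(r, m))
    (B : 'M_(p, m)) C A66 (B6 : 'M_m) z : B6 \in unitmx ->
  is_zero (canon J A Bj B C A66) (col_mx 0 B6) (col_mx 0 B6)^T 0 z <->
  eigenvalue (toCmx J) z \/ eigenvalue (toCmx A) z.
Proof.
move=> uB; rewrite /is_zero.
have unitf (K : fieldType) (f : {rmorphism R -> K}) : map_mx f B6 \in unitmx.
  by rewrite map_unitmx.
have strip (K : fieldType) (f : {rmorphism R -> K}) s :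
    (\rank (pencil s (map_mx f (canon J A Bj B C A66)) (map_mx f (col_mx 0 B6))
      (map_mx f (col_mx 0 B6)^T) (map_mx f (0 : 'M_m))) == r + p + m + m)%N =
    (s%:M - map_mx f (block_mx J 0 0 A) \in unitmx).
  rewrite /canon map_block_mx tr_col_mx trmx0 (map_col_mx f 0 B6).
  rewrite (map_row_mx f 0 B6^T) !map_mx0.
  by apply: pencil_strip_unit; rewrite ?unitf // -map_trmx unitmx_tr unitf.
have -> : \rank (pencil (tofrac 'X) (toFmx (canon J A Bj B C A66))
    (toFmx (col_mx 0 B6)) (toFmx (col_mx 0 B6)^T) (toFmx (0 : 'M[R]_m))) =
    (r + p + m + m)%N.
  apply/eqP; have := strip _ (@tofrac _ \o polyC) (tofrac 'X).
  by rewrite /toFmx => ->; apply: char_frac_unit.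
rewrite ltn_neqAle rank_leq_row andbT (strip _ (real_complex R)).
rewrite map_block_mx !map_mx0 -/(toCmx J) -/(toCmx A) !eigenvalue_unit.
rewrite scalar_mx_block opp_block_mx add_block_mx !oppr0 !addr0.
have -> : (block_mx (z%:M - toCmx J) 0 0 (z%:M - toCmx A) \in unitmx) =
    (z%:M - toCmx J \in unitmx) && (z%:M - toCmx A \in unitmx).
  by rewrite unitmxE det_ublock unitrM -!unitmxE.
rewrite negb_and.
by split=> /orP.
Qed.

Section Regroup.
Variables (r p m l p1 p2 : nat) (J : 'M[R]_r) (A : 'M[R]_p) (Bj : 'M[R]_(r, m))
  (B : 'M[R]_(p, m)) (C : 'M[R]_(m, p)) (A66 : 'M[R]_m).
Variables (W : 'M[R]_(r, m + l)) (V : 'M[R]_(r, l))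
  (Tz : 'M[R]_(p, p1 + p2)) (Tz' : 'M[R]_(p1 + p2, p)).

(** Change of coordinates that splits the conservative part by [W] and [V],
balances the damped part by [Tz], and puts the blocks in their final order. *)
Definition regroup_mx : 'M[R]_(r + p + m, (m + l) + ((p1 + p2) + (l + m))) :=
  row_mx (col_mx (col_mx W 0) 0) (row_mx (col_mx (col_mx 0 Tz) 0)
    (row_mx (col_mx (col_mx V 0) 0) (col_mx 0 1%:M))).

Definition regroup_inv : 'M[R]_((m + l) + ((p1 + p2) + (l + m)), r + p + m) :=
  col_mx (row_mx (row_mx W^T 0) 0) (col_mx (row_mx (row_mx 0 Tz') 0)
    (col_mx (row_mx (row_mx V^T 0) 0) (row_mx 0 1%:M))).

Lemma regroup_mul q (a : 'M_(m + l, q)) (b : 'M_(p1 + p2, q)) (c : 'M_(l, q))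
    (d : 'M_(m, q)) :
  regroup_mx *m col_mx a (col_mx b (col_mx c d)) =
  col_mx (col_mx (W *m a + V *m c) (Tz *m b)) d.
Proof.
rewrite /regroup_mx !mul_row_col !mul_col_mx.
by rewrite !(mul0mx, mul1mx, addr0, add0r, add_col_mx).
Qed.

Lemma canon_mul q (X : 'M_(r, q)) (Y : 'M_(p, q)) (Z : 'M_(m, q)) :
  canon J A Bj B C A66 *m col_mx (col_mx X Y) Z =
  col_mx (col_mx (J *m X + Bj *m Z) (A *m Y + B *m Z))
         (- (Bj^T *m X + C *m Y) + A66 *m Z).
Proof.
rewrite /canon mul_block_col mulNmx mul_row_col mul_block_col !mul_col_mx.
by rewrite !mul0mx addr0 add0r add_col_mx.
Qed.

Lemma col_row_mx (a b c d : nat) (X : 'M[R]_(a, c)) (Y : 'M_(a, d))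
    (X' : 'M_(b, c)) (Y' : 'M_(b, d)) :
  col_mx (row_mx X Y) (row_mx X' Y') = row_mx (col_mx X X') (col_mx Y Y').
Proof. by rewrite -block_mxEv block_mxEh. Qed.

Lemma bal_A_cols A16 A25 A26 A33 A34 A36 A44 A46 :
  @bal_A R m l p1 p2 A16 A25 A26 A33 A34 A36 A44 A46 A66 =
  row_mx (col_mx 0 (col_mx 0 (col_mx (row_mx 0 (- A25^T))
      (row_mx (- A16^T) (- A26^T)))))
    (row_mx (col_mx 0 (col_mx (block_mx A33 A34 (- A34^T) A44)
        (col_mx 0 (row_mx (- A36^T) A46^T))))
      (row_mx (col_mx (col_mx 0 A25) (col_mx 0 (col_mx 0 0)))
        (col_mx (col_mx A16 A26) (col_mx (col_mx A36 A46) (col_mx 0 A66))))).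
Proof.
rewrite /bal_A; cbv zeta; rewrite [LHS]block_mxEh; congr row_mx.
rewrite (block_mxEh 0 A16) (block_mxEh 0 A36) (block_mxEh 0 0 0 A66).
rewrite (block_mxEv 0 0 (- A36^T)) row_mx0.
rewrite (block_mxEh (block_mx A33 A34 _ _)) !col_row_mx !col_mx0.
by [].
Qed.

End Regroup.

End Canonical.

(** * The balanced system *)

Section Assembly.
Variable R : realType.

Lemma regroup_similar (r p m l p1 p2 : nat) (J : 'M[R]_r) (A : 'M[R]_p)
    (Bj : 'M[R]_(r, m)) (B : 'M[R]_(p, m)) (C : 'M[R]_(m, p)) (A66 B6 : 'M[R]_m)
    (W : 'M[R]_(r, m + l)) (V : 'M[R]_(r, l)) (Tz : 'M[R]_(p, p1 + p2)) Tz'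
    A16 A25 A26 A33 A34 A36 A44 A46 :
  [/\ W^T *m W = 1%:M, V^T *m V = 1%:M, W^T *m V = 0 & W *m W^T + V *m V^T = 1%:M] ->
  J *m W = - (V *m row_mx 0 A25^T) -> J *m V = W *m col_mx 0 A25 ->
  Bj = W *m col_mx A16 A26 ->
  similar_by Tz Tz' A B C (block_mx A33 A34 (- A34^T) A44) (col_mx A36 A46)
    (row_mx A36^T (- A46^T)) ->
  similar_by (regroup_mx W V Tz) (regroup_inv W V Tz')
    (canon J A Bj B C A66) (col_mx 0 B6) (col_mx 0 B6)^T
    (bal_A A16 A25 A26 A33 A34 A36 A44 A46 A66)
    (bal_B l p1 p2 B6) (bal_B l p1 p2 B6)^T.
Proof.
move=> [oW oV oWV id1] JW JV hBj [tt1 tt2 hA hB hC].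
have oVW : V^T *m W = 0 by apply: trmx_inj; rewrite trmx_mul trmxK oWV trmx0.
have BW : Bj^T *m W = row_mx A16^T A26^T.
  by rewrite hBj trmx_mul -mulmxA oW mulmx1 tr_col_mx.
have BV : Bj^T *m V = 0 by rewrite hBj trmx_mul -mulmxA oWV mulmx0.
have TB : col_mx 0 B6 = regroup_mx W V Tz *m bal_B l p1 p2 B6.
  by rewrite /bal_B regroup_mul !mulmx0 addr0 col_mx0.
have t1 : regroup_mx W V Tz *m regroup_inv W V Tz' = 1%:M.
  rewrite /regroup_inv regroup_mul !mul_mx_row !mulmx0 !add_row_mx !addr0 id1 tt1.
  by rewrite col_row_mx col_mx0 -!block_mxEv -!scalar_mx_block.
have t2 : regroup_inv W V Tz' *m regroup_mx W V Tz = 1%:M.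
  rewrite /regroup_inv /regroup_mx !mul_col_mx !mul_mx_row !mul_row_col.
  rewrite !(mul0mx, mulmx0, addr0, add0r) oW oV oWV oVW tt2 mul1mx.
  rewrite !(row_mx0, col_mx0).
  by rewrite !(scalar_mx_block, block_mxEv, col_row_mx, col_mx0, row_mx0).
split=> //.
- have last : canon J A Bj B C A66 *m col_mx 0 1%:M = col_mx (col_mx Bj B) A66.
    rewrite -[X in col_mx X _]col_mx0 canon_mul.
    by rewrite !(mulmx0, mulmx1, addr0, add0r, oppr0).
  rewrite bal_A_cols {1}/regroup_mx !mul_mx_row !regroup_mul last !canon_mul.
  rewrite !(mulmx0, mul0mx, addr0, add0r, oppr0, mulmx1).
  rewrite BW BV oppr0 JW JV -hBj hA hB hC.
  by rewrite -mulmxN !opp_row_mx opprK oppr0.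
- rewrite /bal_B !tr_col_mx !trmx0 /regroup_mx !mul_mx_row !mul_row_col.
  by rewrite !(mulmx0, mul0mx, addr0, add0r, mulmx1).
Qed.

Lemma regroup_form (r p m l p1 p2 : nat) (W : 'M[R]_(r, m + l)) (V : 'M[R]_(r, l))
    (Tz : 'M[R]_(p, p1 + p2)) P :
  W^T *m W = 1%:M -> V^T *m V = 1%:M -> W^T *m V = 0 ->
  (regroup_mx W V Tz)^T *m block_mx (block_mx 1%:M 0 0 P) 0 0 1%:M
    *m regroup_mx W V Tz = bal_P m l (Tz^T *m P *m Tz).
Proof.
move=> oW oV oWV.
have oVW : V^T *m W = 0 by apply: trmx_inj; rewrite trmx_mul trmxK oWV trmx0.
rewrite -mulmxA /bal_P {2}/regroup_mx !mul_mx_row !mul_block_col.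
rewrite !(mulmx0, mul0mx, addr0, add0r, mul1mx, col_mx0, mul_block_col).
rewrite /regroup_mx !tr_row_mx !tr_col_mx !trmx0 trmx1 !mul_col_mx !mul_row_col.
rewrite !(mulmx0, mul0mx, addr0, add0r, mul1mx) oW oV oWV oVW -!mulmxA.
rewrite (scalar_mx_block l m 1) !block_mxEv.
by rewrite !(=^~ col_row_mx, col_mx0, row_mx0).
Qed.

(** The signature under which the balanced system is symmetric. *)
Definition bal_S (m l p1 p2 : nat) : 'M[R]_((m + l) + ((p1 + p2) + (l + m))) :=
  block_mx (- 1%:M) 0 0 (block_mx (block_mx (- 1%:M) 0 0 1%:M) 0 0 1%:M).

Lemma sig_mxK (p q : nat) (X : 'M[R]_q) : X *m X = 1%:M ->
  block_mx (- (1%:M : 'M[R]_p)) 0 0 X *m block_mx (- 1%:M) 0 0 X = 1%:M.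
Proof.
move=> h; rewrite mulmx_block !(mulmx0, mul0mx, addr0, add0r) h.
by rewrite mulNmx mulmxN opprK mul1mx -scalar_mx_block.
Qed.

Lemma sig_block_sym (a b c : nat) (X : 'M[R]_(a, c)) (S A : 'M[R]_b)
    (Y : 'M[R]_(b, c)) (Y' : 'M[R]_(c, b)) (E : 'M[R]_c) :
  S^T = S -> S *m A = A^T *m S -> S *m Y = Y'^T -> E^T = E ->
  let M := block_mx 0 (row_mx 0 X) (col_mx 0 (- X^T)) (block_mx A Y Y' E) in
  let Sg := block_mx (- 1%:M) 0 0 (block_mx S 0 0 1%:M) in
  Sg *m M = M^T *m Sg.
Proof.
move=> sS SA SY sE /=.
rewrite tr_block_mx tr_row_mx tr_col_mx tr_block_mx !trmx0 linearN /= trmxK sE.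
rewrite !mulmx_block mul_mx_row mul_row_block mul_block_col.
rewrite !(mulmx0, mul0mx, addr0, add0r, mul1mx, mulmx1, mulNmx, mulmxN).
have -> : Y^T *m S = Y' by rewrite -sS -trmx_mul SY trmxK.
by rewrite SA SY opp_col_mx !oppr0.
Qed.

Lemma bal_symmetric (m l p1 p2 : nat) A16 A25 A26 A33 A34 A36 A44 A46 A66 B6 :
  A33^T = A33 -> A44^T = A44 -> A66^T = A66 ->
  let Ab := @bal_A R m l p1 p2 A16 A25 A26 A33 A34 A36 A44 A46 A66 in
  let Bb := bal_B l p1 p2 B6 in
  let S := bal_S m l p1 p2 in
  [/\ S *m S = 1%:M, S^T = S, S *m Ab = Ab^T *m S & S *m Bb = Bb].
Proof.
move=> s33 s44 s66 Ab Bb S; rewrite /S; split.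
- apply: sig_mxK; rewrite mulmx_block !(mulmx0, mul0mx, addr0, add0r) mulmx1.
  by rewrite sig_mxK ?mulmx1 // -scalar_mx_block.
- by rewrite /bal_S !tr_block_mx !trmx0 !linearN /= !trmx1.
- rewrite /Ab /bal_S /bal_A; cbv zeta.
  have -> : block_mx 0 (- A25^T) (- A16^T) (- A26^T) = - (block_mx 0 A16 A25 A26)^T.
    by rewrite tr_block_mx opp_block_mx trmx0 oppr0.
  have trN a b (X : 'M[R]_(a, b)) : (- X^T)^T = - X by rewrite linearN /= trmxK.
  apply: sig_block_sym.
  + by rewrite tr_block_mx !trmx0 linearN /= !trmx1.
  + rewrite tr_block_mx !mulmx_block s33 s44 trN.
    by rewrite !(mulmx0, mul0mx, addr0, add0r, mul1mx, mulmx1, mulNmx, mulmxN).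
  + rewrite tr_block_mx mulmx_block !trmx0 trN trmxK.
    by rewrite !(mulmx0, mul0mx, addr0, add0r, mul1mx, mulNmx, oppr0).
  + by rewrite tr_block_mx !trmx0 s66.
- by rewrite /Bb /bal_S /bal_B !mul_block_col
     !(mulmx0, mul0mx, addr0, add0r, mul1mx, oppr0, mulNmx).
Qed.

Lemma bal_P_diag (m l p1 p2 : nat) (d : 'rV[R]_(p1 + p2)) :
  bal_P m l (diag_mx d) =
  diag_mx (row_mx (const_mx 1) (row_mx d (const_mx 1))).
Proof. by rewrite /bal_P !diag_mx_row !diag_const_mx. Qed.

Lemma bal_minimal_dual (m l p1 p2 : nat) A16 A25 A26 A33 A34 A36 A44 A46 A66 B6
    (d : 'rV[R]_(p1 + p2)) :
  A33^T = A33 -> A44^T = A44 -> A66^T = A66 ->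
  let Ab := @bal_A R m l p1 p2 A16 A25 A26 A33 A34 A36 A44 A46 A66 in
  let Bb := bal_B l p1 p2 B6 in
  minimal_kyp_solution Ab Bb Bb^T 0 (bal_P m l (diag_mx d)) ->
  minimal_kyp_solution Ab^T Bb^T^T Bb^T 0 (bal_P m l (diag_mx d)).
Proof.
move=> s33 s44 s66 Ab Bb; rewrite -{2}(trmx0 R m m).
have [SS sS SA SB] := bal_symmetric A16 A25 A26 A34 A36 A46 B6 s33 s44 s66.
apply: (minimal_kyp_dual SS sS SA); rewrite ?trmxK ?trmx0 //.
have -> : bal_S m l p1 p2 = diag_mx (row_mx (const_mx (-1))
    (row_mx (row_mx (const_mx (-1)) (const_mx 1)) (const_mx 1))).
  by rewrite /bal_S !diag_mx_row !diag_const_mx !raddfN.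
by rewrite bal_P_diag diag_mxC.
Qed.

(** In coordinates that diagonalize both the minimal solution and the form, the
form is a signature. Symmetry with respect to it yields the block pattern, and
it makes the dual minimal solution equal to the primal one. *)
Lemma balanced_coordinates (p m : nat) (A S : 'M[R]_p) (B : 'M_(p, m)) C D :
  damped A -> reachable A B -> psd_kyp_solution A B C D 1%:M ->
  S^T = S -> S *m A = A^T *m S -> S *m B = - C^T ->
  (forall x : 'cV_p, S *m x = 0 -> x = 0) -> D^T = D ->
  exists p1 p2 (T : 'M[R]_(p, p1 + p2)) (T' : 'M_(p1 + p2, p))
    (A33 : 'M_p1) (A34 : 'M_(p1, p2)) A36 (A44 : 'M_p2) A46 P
    (d : 'rV_(p1 + p2)),
  let A' := block_mx A33 A34 (- A34^T) A44 in
  let B' := col_mx A36 A46 in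
  let C' := row_mx A36^T (- A46^T) in
  [/\ similar_by T T' A B C A' B' C', A33^T = A33 /\ A44^T = A44,
      minimal_kyp_solution A B C D P /\ T^T *m P *m T = diag_mx d,
      minimal_kyp_solution A'^T C'^T B'^T D^T (diag_mx d)
    & forall i, 0 < d 0 i].
Proof.
move=> dA rA kyp sS SA SB Sinj sD.
have u1 : 1%:M - A \in unitmx.
  apply: unitmx_inj => x; rewrite mulmxBl mul1mx => /eqP; rewrite subr_eq0 => /eqP h.
  apply: dot_eq0; apply/eqP; rewrite eq_le dot_ge0 andbT {2}h.
  have [_ /(_ x)] := (psdmxP _).1 dA.1.
  rewrite mulNmx mulmxDl dotNr dotDr (dot_adj A^T) trmxK -h.
  by lra.
have [P hP] := minimal_kyp_exists u1 kyp.
have rD : reachable A^T C^T.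
  apply: (reachable_dual (unitmx_inj Sinj) SA _ rA); by right.
have spdP := kyp_spd rD hP.1.
have [p1 [p2 [T [T' [d [TT' T'T dp dP dS]]]]]] := balance_forms spdP sS Sinj.
pose A' := T' *m A *m T; pose B' := T' *m B; pose C' := C *m T.
have AT : A *m T = T *m A' by rewrite /A' !mulmxA TT' mul1mx.
have BT : B = T *m B' by rewrite /B' mulmxA TT' mul1mx.
set Sig := block_mx _ _ _ _ in dS.
have SigA : Sig *m A' = A'^T *m Sig.
  have TA' : A'^T *m T^T = T^T *m A^T by rewrite -!trmx_mul AT.
  rewrite -dS -(mulmxA _ T A') -AT !(mulmxA A'^T) TA'.
  by rewrite -(mulmxA T^T S) (mulmxA S) SA !mulmxA.
have SigB : Sig *m B' = - C'^T.
  by rewrite -dS -(mulmxA _ T B') -BT -mulmxA SB mulmxN trmx_mul.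
have A'E : A' = block_mx (ulsubmx A') (ursubmx A') (dlsubmx A') (drsubmx A').
  by rewrite submxK.
move: (SigA); rewrite {1 2}A'E /Sig tr_block_mx !mulmx_block.
rewrite !(mulmx0, mul0mx, addr0, add0r, mul1mx, mulmx1, mulNmx, mulmxN).
move=> /eq_block_mx[/oppr_inj s33 _ s43 s44].
have {}A'E : A' = block_mx (ulsubmx A') (ursubmx A') (- (ursubmx A')^T) (drsubmx A').
  by rewrite {1}A'E s43.
have C'E : C' = row_mx (usubmx B')^T (- (dsubmx B')^T).
  apply: trmx_inj; apply: oppr_inj; rewrite -SigB -{1}[B']vsubmxK mul_block_col.
  rewrite !(mul0mx, addr0, add0r, mul1mx, mulNmx) tr_row_mx linearN /= !trmxK.
  by rewrite opp_col_mx opprK.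
have sim : similar_by T T' A B C (block_mx (ulsubmx A') (ursubmx A')
    (- (ursubmx A')^T) (drsubmx A')) (col_mx (usubmx B') (dsubmx B'))
    (row_mx (usubmx B')^T (- (dsubmx B')^T)).
  by split; rewrite -?A'E ?vsubmxK.
exists p1, p2, T, T', (ulsubmx A'), (ursubmx A'), (usubmx B'), (drsubmx A'),
  (dsubmx B'), P, d => /=; split=> //.
have hP' : minimal_kyp_solution A' B' C' D (diag_mx d).
  by rewrite -dP; apply: (minimal_kyp_similar TT' T'T AT BT erefl hP).
rewrite -A'E vsubmxK -C'E.
apply: (@minimal_kyp_dual _ _ _ _ (- Sig)) hP' => //.
- rewrite mulNmx mulmxN opprK; apply: sig_mxK; exact: mulmx1.
- by rewrite /Sig linearN /= tr_block_mx !trmx0 linearN /= !trmx1.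
- by rewrite mulNmx mulmxN SigA.
- by rewrite mulNmx SigB opprK.
- have -> : Sig = diag_mx (row_mx (const_mx (-1)) (const_mx 1)).
    by rewrite diag_mx_row !diag_const_mx raddfN.
  by rewrite mulNmx mulmxN diag_mxC.
Qed.

End Assembly.

(** * The second-order system *)

(** The energy is [x^T x / 2], dissipated by [D] only, and reversal of the first
component exchanges the system with its dual. A constant force [B u] is balanced by a
static first component [- G^-1 B u] with zero velocity, whence the equilibrium. *)
Lemma second_order_collocated (R : realType) (n m : nat) (G D : 'M[R]_n)
    (B : 'M[R]_(n, m)) : G \in unitmx -> psdmx D ->
  let cA : 'M[R]_(n + n) := block_mx 0 G^T (- G) (- D) in
  let cB : 'M[R]_(n + n, m) := col_mx 0 B in
  cA \in unitmx /\
  collocated cA cB (block_mx (- 1%:M) 0 0 1%:M) (col_mx (- (invmx G *m B)) 0).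
Proof.
move=> uG /psdmxP[sD hD] cA cB; split.
  apply: unitmx_inj => x; rewrite -[x]vsubmxK mul_block_col mul0mx add0r !mulNmx.
  move/eqP; rewrite col_mx_eq0 => /andP[/eqP e1 /eqP e2].
  have x2 : dsubmx x = 0.
    by rewrite -(mulKmx (_ : G^T \in unitmx) (dsubmx x)) ?unitmx_tr // e1 mulmx0.
  move: e2; rewrite x2 mulmx0 subr0 => /eqP; rewrite oppr_eq0 => /eqP e2.
  by rewrite -(mulKmx uG (usubmx x)) e2 mulmx0 col_mx0.
split.
- apply/kyp_dissipation; split; first exact: psdmx1.
  move=> x u; rewrite -[x]vsubmxK mul1mx mul_block_col mul_col_mx tr_col_mx trmx0.
  rewrite mul_row_col !(mul0mx, add0r, addr0, add_col_mx) dot_col_mx !dotDr.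
  rewrite dot_adj trmxK !mulNmx !dotNr dotC (dot_adj B^T) trmxK (dotC (B *m u)).
  have := hD (dsubmx x); lra.
- by rewrite tr_block_mx !trmx0 linearN /= !trmx1.
- have trN (X : 'M[R]_n) : (- X)^T = - X^T by rewrite linearN.
  rewrite tr_block_mx !trmx0 trmxK !trN sD !mulmx_block.
  by rewrite !(mulmx0, mul0mx, addr0, add0r, mul1mx, mulmx1, mulNmx, mulmxN,
    opprK, oppr0).
- by rewrite mul_block_col !(mulmx0, mul0mx, addr0, add0r, mul1mx).
- split; last by rewrite tr_col_mx trmx0 mul_row_col mulmx0 mul0mx addr0.
  rewrite mul_block_col !(mulmx0, mul0mx, addr0, add0r) mulNmx mulmxN opprK.
  by rewrite mulKVmx.
Qed.

Theorem theorem5p4 (R : realType) (n m : nat)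
    (G D : 'M[R]_n) (B : 'M[R]_(n, m))
    (hG : G \in unitmx) (hDsym : D = D^T) (hD : psdmx D)
    (hB : forall x : 'cV[R]_m, B *m x = 0 -> x = 0) :
  let cA : 'M[R]_(n + n) := block_mx 0 G^T (- G) (- D) in
  let cB : 'M[R]_(n + n, m) := col_mx 0 B in
  let cC : 'M[R]_(m, n + n) := cB^T in
  stabilizable cA cB ->
  has_semisimple_zeros cA cB cC 0 ->
  exists (l p1 p2 : nat)
    (A16 : 'M[R]_m) (A25 : 'M[R]_l) (A26 : 'M[R]_(l, m))
    (A33 : 'M[R]_p1) (A34 : 'M[R]_(p1, p2)) (A36 : 'M[R]_(p1, m))
    (A44 : 'M[R]_p2) (A46 : 'M[R]_(p2, m)) (A66 : 'M[R]_m)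
    (B6 : 'M[R]_m) (Pi : 'M[R]_(p1 + p2)),
  let Ab := bal_A A16 A25 A26 A33 A34 A36 A44 A46 A66 in
  let Bb := bal_B l p1 p2 B6 in
  let Cb := Bb^T in
  let P := bal_P m l Pi in
  let Az : 'M[R]_(p1 + p2) := block_mx A33 A34 (- A34^T) A44 in
  let Bz : 'M[R]_(p1 + p2, m) := col_mx A36 A46 in
  let Cz : 'M[R]_(m, p1 + p2) := row_mx A36^T (- A46^T) in
  let Dz : 'M[R]_m := - A66 in
  [/\ A16 \in unitmx /\ B6 \in unitmx,
      [/\ transfer Ab Bb Cb 0 = transfer cA cB cC 0,
          minimal_system Ab Bb Cb
        & positive_real_balanced Ab Bb Cb 0],
      [/\ is_diag_mx Pi,
          minimal_kyp_solution Ab Bb Cb 0 P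
        & minimal_kyp_solution Ab^T Cb^T Bb^T 0 P],
      [/\ asymp_stable Az,
          positive_real_balanced Az Bz Cz Dz,
          minimal_kyp_solution Az Bz Cz Dz Pi
        & minimal_kyp_solution Az^T Cz^T Bz^T Dz^T Pi]
    & forall z : R[i],
        eigenvalue (toCmx Az) z <->
        is_zero Ab Bb Cb 0 z /\ complex.Re z < 0].
Proof.
move=> cA cB cC _ _.
have [uA col0] := second_order_collocated B hG hD.
have [N1 [A1 [B1 [S1 [Z1 [col1 rch1 [X1 e1] t1]]]]]] := collocated_reach uA col0.
have [N2 [A2 [B2 [S2 [Z2 [col2 rch2 uS2 [X2 e2] t2]]]]]] :=
  collocated_nondegenerate col1 rch1.
have B2inj (x : 'cV_m) : B2 *m x = 0 -> x = 0.
  move=> hx; apply: hB; have : cB *m x = 0.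
    by rewrite /cB e1 e2 -!mulmxA hx !mulmx0.
  by rewrite mul_col_mx => /eqP; rewrite col_mx_eq0 => /andP[_ /eqP].
have [k [T [A00 [A06 [A60 [A66 [B6 [S0 [Z0 [
  [TT T1 AT BT] uB6] [sS SA SB s66 Sinj] kyp rch [AZ CZ]]]]]]]]]] :=
  collocated_strip col2 rch2 uS2 B2inj.
have SA' : S0 *m A06 = - (- A60)^T by rewrite [in RHS]linearN /= opprK.
have CZ' : - (- A60) *m Z0 = B6 by rewrite opprK.
have [r [p [W0 [J [Az [Bj [Bz [Cz [Sj [Sz [y [
  [W1 W2 AW BW CW] [sJ rJ sSj SjSj] [SJ SBj Jy By] [dAz rAz kypz]
  [sSz SAz SBz Szinj]]]]]]]]]]]]] :=
  collocated_split sS SA SA' Sinj kyp rch AZ CZ'.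
have [l [W [V [A16 [A25 [A26 [oWV JW JV BjE uA16]]]]]]] :=
  conservative_blocks sJ rJ sSj SjSj SJ SBj Jy By uB6.
have sD : (- A66)^T = - A66 by rewrite linearN /= s66.
have [p1 [p2 [Tz [Tz' [A33 [A34 [A36 [A44 [A46 [P [d [
  simz [s33 s44] [hP dP] dualz dp]]]]]]]]]]]] :=
  balanced_coordinates dAz rAz kypz sSz SAz SBz Szinj sD.
pose Pi := diag_mx d.
exists l, p1, p2, A16, A25, A26, A33, A34, A36, A44, A46, A66, B6, Pi.
move=> Ab Bb Cb P' Az' Bz' Cz' Dz'.
(* input coordinates, then the splitting of the zero dynamics, then balancing *)
have sim1 : similar_by T T^T A2 B2 B2^T (block_mx A00 A06 A60 A66)
    (col_mx 0 B6) (col_mx 0 B6)^T.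
  by split=> //; rewrite {1}BT trmx_mul -mulmxA T1 mulmx1.
have sim2 : similar_by (block_mx W0 0 0 1%:M) (block_mx W0^T 0 0 1%:M)
    (block_mx A00 A06 A60 A66) (col_mx 0 B6) (col_mx 0 B6)^T
    (canon J Az Bj Bz Cz A66) (col_mx 0 B6) (col_mx 0 B6)^T.
  have CW' : A60 *m W0 = - row_mx Bj^T Cz by rewrite -CW mulNmx opprK.
  split; rewrite ?tr_col_mx ?trmx0 ?/canon ?mulmx_block ?mul_block_col ?mul_row_block;
    rewrite !(mulmx0, mul0mx, addr0, add0r, mul1mx, mulmx1) ?W1 ?W2 //.
  - by rewrite -scalar_mx_block.
  - by rewrite -scalar_mx_block.
  - by rewrite AW {1}BW CW'.
have sim3 := regroup_similar A66 B6 oWV JW JV BjE simz.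
have sim := similar_trans sim1 (similar_trans sim2 sim3).
have rAb : reachable Ab Bb by apply: similar_reachable sim rch2.
have minc := canon_minimal_kyp uB6 sJ dAz rJ hP.
have minb : minimal_kyp_solution Ab Bb Cb 0 P'.
  have [t1' t2' hA hB' hC] := sim3.
  have [oW oV oWV' _] := oWV.
  have <- : (regroup_mx W V Tz)^T *m block_mx (block_mx 1%:M 0 0 P) 0 0 1%:M
      *m regroup_mx W V Tz = P' by rewrite (regroup_form _ _ oW oV oWV') dP.
  exact: minimal_kyp_similar t1' t2' hA hB' hC minc.
have minz : minimal_kyp_solution Az' Bz' Cz' Dz' Pi.
  have [t1' t2' hA hB' hC] := simz.
  by have := minimal_kyp_similar t1' t2' hA hB' hC hP; rewrite dP.
have duab : minimal_kyp_solution Ab^T Cb^T Bb^T 0 P'.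
  exact: bal_minimal_dual minb.
have zeros z : is_zero Ab Bb Cb 0 z <->
    eigenvalue (toCmx J) z \/ eigenvalue (toCmx Az) z.
  rewrite -(canon_is_zero J Az Bj Bz Cz A66 z uB6).
  by apply: iff_sym; apply: is_zero_similar sim3.
have stable : asymp_stable Az'.
  by move=> z /(eigenvalue_similar simz); apply: damped_stable.
have obs : reachable Ab^T Cb^T.
  have [SbSb _ SbA SbB] := bal_symmetric A16 A25 A26 A34 A36 A46 B6 s33 s44 s66.
  have [uSb _] := mulmx1_unit SbSb.
  by apply: (reachable_dual uSb SbA _ rAb); left; rewrite trmxK.
split.
- by [].
- split.
  + have [_ _ hA hB' hC] := sim.
    exact: (esym (etrans t1 (etrans t2 (transfer_intertwine 0 hA hB' hC)))).
  + split; [exact: reachable_controllable | exact: reachable_observable].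
  + have e : P' = _ := bal_P_diag m l d.
    apply: (@diag_balanced _ _ _ _ _ _ _
      (row_mx (const_mx 1) (row_mx d (const_mx 1)))); rewrite -?e ?trmx0 //.
    move=> i; rewrite mxE; case: split => j; rewrite mxE //.
    by case: split => j'; rewrite ?mxE.
- by split; [exact: diag_mx_is_diag | exact: minb | exact: duab].
- by split; [exact: stable | exact: diag_balanced dp minz dualz | exact: minz
    | exact: dualz].
- move=> z; split.
    move=> hz; split; last exact: stable.
    by apply/zeros; right; apply: eigenvalue_similar simz hz.
  move=> [/zeros[hz|hz] rz].
    by move: rz; rewrite (skew_eigenvalue sJ hz) ltxx.
  apply: eigenvalue_similar (similar_sym simz) hz.
Qed.
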